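(* Let $E\subset\mathbb{T}$ be a set of Lebesgue measure zero. Then there exists a subalgebra $\mathcal{B}$ of $H^\infty$ of algebraic dimension $\mathfrak{c}$ (that is, generated by an algebraically independent set of cardinality $\mathfrak{c}$) such that every non-zero $f\in\mathcal{B}$ satisfies: for every $w\in E$, the radial limit $\lim_{r\to 1^-} f(r\,w)$ fails to exist. In other words, the set of functions $f\in H^\infty$ such that $\lim_{r\to1^-}f(r\,w)$ fails to exist for every $w\in E$ is strongly $\mathfrak{c}$-algebrable.
   Context: $\mathbb{D}$ is the open unit disc of $\mathbb{C}$ and $\mathbb{T}$ is its boundary. $H^\infty$ is the algebra of bounded holomorphic functions $f:\mathbb{D}\to\mathbb{C}$ (with pointwise operations). $\mathfrak{c}$ is the cardinality of the continuum. For a commutative (complex) algebra $\mathcal{A}$ and an infinite cardinal $\kappa$, a subset $C\subset\mathcal{A}$ is strongly $\kappa$-algebrable if $C\cup\{0\}$ contains a subalgebra of $\mathcal{A}$ generated by an algebraically independent set of cardinality $\kappa$. Subalgebras are not required to contain the unit: the subalgebra generated by a set $G$ consists of all values $Q(g_1,\dots,g_N)$ of complex polynomials $Q$ without constant term at elements $g_1,\dots,g_N\in G$. A set $G$ is algebraically independent if $Q(g_1,\dots,g_N)\neq0$ for all distinct $g_1,\dots,g_N\in G$ and all non-zero complex polynomials $Q$ in $N$ variables. *)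

(* Defs.v *)
From HB Require Import structures.
From mathcomp Require Import all_boot all_order all_algebra.
From mathcomp Require Import all_classical all_reals all_analysis.
From mathcomp Require Import complex.
(* The notations of mpoly clash with those of mathcomp-analysis. *)
From mathcomp Require Import -(notations) mpoly.

Set Implicit Arguments.
Unset Strict Implicit.
Unset Printing Implicit Defensive.

Import Order.TTheory GRing.Theory Num.Theory.
Import numFieldNormedType.Exports.

Local Open Scope classical_set_scope.
Local Open Scope complex_scope.
Local Open Scope ring_scope.

(* The topology of the modulus; C is a normed space over itself, so that
   `derivable f z 1` for f : R[i] -> R[i] is complex differentiability at z. *)
HB.instance Definition _ (R : rcfType) := NormedModule.copy R[i] R[i]^o.

Section Algebrability.
Variables (K : fieldType) (A : comAlgType K).

Definition mpoly_eval (N : nat) (Q : mpoly N K) (g : 'I_N -> A) : A :=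
  mmap (in_alg A) g Q.

Definition alg_independent (G : set A) : Prop :=
  forall (N : nat) (g : 'I_N -> A), (forall i, G (g i)) -> injective g ->
  forall Q : mpoly N K, Q != 0 -> mpoly_eval Q g != 0.

(* Not necessarily unital: only polynomials without constant term are used. *)
Definition generated_subalg (G : set A) : set A :=
  [set a | exists (N : nat) (g : 'I_N -> A) (Q : mpoly N K),
    [/\ forall i, G (g i), mcoeff (mnm0 (n := N)) Q = 0
      & a = mpoly_eval Q g]].

(* Cardinals are represented by sets: the dimension is the cardinal of k. *)
Definition subalg_of_dimension (T : Type) (k : set T) (B : set A) : Prop :=
  exists G : set A,
    [/\ alg_independent G, (G #= k)%card & B = generated_subalg G].

Definition strongly_algebrable (T : Type) (k : set T) (C : set A) : Prop :=
  exists B : set A, subalg_of_dimension k B /\ B `<=` C `|` [set 0].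

End Algebrability.

Section Hinfty.
Variable R : realType.

Definition disc : Type := {z : R[i] | `|z| < 1}.

HB.instance Definition _ := Choice.on disc.

Let disc0_subproof : `|0 : R[i]| < 1. Proof. by rewrite normr0 ltr01. Qed.

HB.instance Definition _ := isPointed.Build disc (exist _ 0 disc0_subproof).

(* Extension by zero of a function on the disc; the values outside the open
   disc affect neither derivatives in the disc nor radial limits. *)
Definition disc_ext (f : disc -> R[i]) (z : R[i]) : R[i] :=
  oapp f 0 (insub z).

Definition holomorphic_disc (f : disc -> R[i]) : Prop :=
  forall z : R[i], `|z| < 1 -> derivable (disc_ext f) z 1.

Definition bounded_disc (f : disc -> R[i]) : Prop :=
  exists M : R, forall z : disc, `|f z| <= M%:C.

Definition Hinf_pred : {pred disc -> R[i]} :=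
  [pred f | `[< holomorphic_disc f /\ bounded_disc f >]].

Lemma disc_ext_in (f : disc -> R[i]) (z : R[i]) (hz : `|z| < 1) :
  disc_ext f z = f (exist _ z hz).
Proof.
rewrite /disc_ext; case: insubP => [u _ uz|]; last by rewrite hz.
by congr f; apply: val_inj.
Qed.

Lemma holomorphic_cst (c : R[i]) : holomorphic_disc (cst c).
Proof.
move=> z z1; apply: (@near_eq_derivable _ _ _ (cst c)); last first.
  exact: derivable_cst.
have : nbhs z (ball (0 : R[i]) 1).
  by apply: open_nbhs_nbhs; split; [exact: ball_open|
    rewrite -ball_normE /ball_ /= sub0r normrN].
apply: filterS => y; rewrite -ball_normE /ball_ /= sub0r normrN => y1.
by rewrite (disc_ext_in _ y1).
Qed.

Lemma holomorphicB (f g : disc -> R[i]) :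
  holomorphic_disc f -> holomorphic_disc g -> holomorphic_disc (f - g).
Proof.
move=> hf hg z z1.
have -> : disc_ext (f - g) = disc_ext f - disc_ext g.
  apply/funext => y; rewrite !fctE /disc_ext /=.
  by case: insub => //=; rewrite subrr.
by apply: derivableB; [exact: hf|exact: hg].
Qed.

Lemma holomorphicM (f g : disc -> R[i]) :
  holomorphic_disc f -> holomorphic_disc g -> holomorphic_disc (f * g).
Proof.
move=> hf hg z z1.
have -> : disc_ext (f * g) = disc_ext f * disc_ext g.
  apply/funext => y; rewrite !fctE /disc_ext /=.
  by case: insub => //=; rewrite mulr0.
by apply: derivableM; [exact: hf|exact: hg].
Qed.

Lemma bounded_cst (c : R[i]) : bounded_disc (cst c).
Proof. by exists (complex.Re `|c|) => z; rewrite RRe_real ?normr_real. Qed.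

Lemma boundedB (f g : disc -> R[i]) :
  bounded_disc f -> bounded_disc g -> bounded_disc (f - g).
Proof.
move=> [M hM] [N hN]; exists (M + N) => z; rewrite rmorphD /=.
by apply: (le_trans (ler_normB _ _)); apply: lerD; [exact: hM|exact: hN].
Qed.

Lemma boundedM (f g : disc -> R[i]) :
  bounded_disc f -> bounded_disc g -> bounded_disc (f * g).
Proof.
move=> [M hM] [N hN]; exists (M * N) => z; rewrite rmorphM /= normrM.
by apply: ler_pM.
Qed.

Lemma Hinf_subring_closed : subring_closed Hinf_pred.
Proof.
split=> [|f g|f g]; rewrite ?inE.
- by split; [exact: holomorphic_cst|exact: bounded_cst].
- by move=> [? ?] [? ?]; split; [exact: holomorphicB|exact: boundedB].
- by move=> [? ?] [? ?]; split; [exact: holomorphicM|exact: boundedM].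
Qed.

HB.instance Definition _ :=
  GRing.isSubringClosed.Build (disc -> R[i]) Hinf_pred Hinf_subring_closed.

Lemma Hinf_scaler_closed : GRing.scaler_closed Hinf_pred.
Proof.
move=> c f; rewrite !inE => -[hf bf]; have -> : c *: f = cst c * f by [].
by split; [exact/holomorphicM/hf/holomorphic_cst|exact/boundedM/bf/bounded_cst].
Qed.

HB.instance Definition _ :=
  GRing.isScaleClosed.Build R[i] (disc -> R[i]) Hinf_pred Hinf_scaler_closed.

Definition Hinf : Type := {f : disc -> R[i] | f \in Hinf_pred}.

HB.instance Definition _ := [isSub of Hinf for @sval _ _].
HB.instance Definition _ := [Choice of Hinf by <:].
HB.instance Definition _ := [SubChoice_isSubComNzRing of Hinf by <:].
HB.instance Definition _ := [SubZmodule_isSubLmodule of Hinf by <:].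

Lemma Hinf_scalerAl (k : R[i]) (f g : Hinf) : k *: (f * g) = (k *: f) * g.
Proof. by apply/val_inj/funext => z; exact: mulrA. Qed.

HB.instance Definition _ :=
  GRing.Lmodule_isLalgebra.Build R[i] Hinf Hinf_scalerAl.

Lemma Hinf_scalerAr (k : R[i]) (f g : Hinf) : k *: (f * g) = f * (k *: g).
Proof. by rewrite mulrC Hinf_scalerAl mulrC. Qed.

HB.instance Definition _ :=
  GRing.Lalgebra_isAlgebra.Build R[i] Hinf Hinf_scalerAr.

Definition has_radial_limit (f : Hinf) (w : R[i]) : Prop :=
  cvg (disc_ext (\val f) (r%:C * w) @[r --> (1 : R)^'-]).

Definition unit_circle : set R[i] := [set w | `|w| = 1].

(* Null for arc length; E need not be Borel, so this is negligibility, i.e.,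
   nullity for the completed measure. *)
Definition circle_null (E : set R[i]) : Prop :=
  (@lebesgue_measure R).-negligible
    (`[0, 2 * pi[ `&` [set t : R | E (cos t +i* sin t)]).

End Hinfty.

Arguments unit_circle R : clear implicits.

(* Main.v *)
Require Import Defs.
From mathcomp Require Import all_boot all_order all_algebra.
From mathcomp Require Import all_classical all_reals all_analysis.
From mathcomp Require Import complex.
From mathcomp Require Import ring lra zify.
From mathcomp Require Import -(notations) mpoly.

Set Implicit Arguments.
Unset Strict Implicit.
Unset Printing Implicit Defensive.

Import Order.TTheory GRing.Theory Num.Theory.
Import numFieldNormedType.Exports.
Import ComplexField.

Local Open Scope classical_set_scope.
Local Open Scope ring_scope.

(** The functions are exponentials [g_c = exp (i c Z)], [c > 0], of one
    holomorphic function [Z] on the disc, called [phase] below. It satisfies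
    [|Im Z| <= 2], which makes every [g_c] bounded, and for each [w] in [E] it
    satisfies [Re Z (r w) -> +oo] and [Im Z (r w) -> 0] as [r -> 1].

    Construction of [Z]. As [E] is null, for each [n] it is covered by arcs of
    half-lengths [d n k] with sum over [k] at most [2 ^ - n]. To an arc centred at
    [u], of half-length [d], is attached the rational function
    [d / (1 + d - z / u)]: its real part is positive on the disc, and at least
    [1/9] at [r w] if [w] is in the arc and [1 - r <= d]. The sum [pole_sum] of
    all of these has nonnegative real part, which tends to infinity along the
    radii ending in [E] (lemma [pole_sum_radial]). To bound the imaginary part,
    a logarithm-like function is applied,
    [dig z = \sum_(n >= 1) (1 / n - 1 / (z + n))]; on the right half-plane it
    satisfies [0 <= Re (dig z)], [|Im (dig z)| <= 2] and
    [|Im (dig z)| <= |Im z| / Re z], and [Re (dig z)] tends to infinity with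
    [Re z]. Hence [Z = dig (dig pole_sum)] has the properties above.

    Absence of radial limits. A polynomial in the generators [g_c] is an
    exponential sum [\sum_k a_k exp (i s_k Z)] (lemma [mpoly_eval_gen]). If it
    has a radial limit at [w] in [E], then the trigonometric polynomial
    [\sum_k a_k exp (i s_k x)] has the same limit as [x] tends to [+oo], because
    [Re Z (r w)] takes all large values, by the intermediate value theorem, and
    [Im Z (r w)] tends to [0] (lemma [exp_sum_radial]). For distinct frequencies
    this forces [a_k = 0] whenever [s_k != 0] (lemma [trig_poly_limit]). Without
    constant term all the frequencies are positive, and so the sum vanishes.

    Independence. The numbers [c] are taken in an explicit rationally independent
    family indexed by the reals (lemma [trace_real_relation]), so that distinct
    monomials have distinct frequencies. The zero function has radial limits; the
    argument above then shows that a polynomial relation between distinct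
    generators has all its nonconstant coefficients zero, hence its constant
    coefficient too. This uses one radius, the one ending in [1], which is
    included among the covered points so that it exists even if [E] is empty. *)

Local Notation Re := complex.Re.
Local Notation Im := complex.Im.

(** * Modulus and absolutely convergent series of complex numbers *)

Section Modulus.
Variable R : realType.
Local Open Scope complex_scope.
Implicit Types z w : R[i].

(** The modulus as a real number: [`|z|] is the complex number [(cmod z)%:C]. *)
Definition cmod z : R := Normc.normc z.

Lemma normrE z : `|z| = (cmod z)%:C.
Proof. by []. Qed.

Lemma ReD z w : Re (z + w) = Re z + Re w. Proof. by case: z; case: w. Qed.
Lemma ImD z w : Im (z + w) = Im z + Im w. Proof. by case: z; case: w. Qed.
Lemma ReN z : Re (- z) = - Re z. Proof. by case: z. Qed.
Lemma ImN z : Im (- z) = - Im z. Proof. by case: z. Qed.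
Lemma ReM z w : Re (z * w) = Re z * Re w - Im z * Im w.
Proof. by case: z; case: w. Qed.
Lemma ImM z w : Im (z * w) = Re z * Im w + Im z * Re w.
Proof. by case: z; case: w. Qed.
Lemma ReV z : Re z^-1 = Re z / (Re z ^+ 2 + Im z ^+ 2).
Proof. by case: z. Qed.
Lemma ImV z : Im z^-1 = - Im z / (Re z ^+ 2 + Im z ^+ 2).
Proof. by case: z => a b /=; rewrite mulNr. Qed.

Definition ReImE := (ReD, ImD, ReN, ImN, ReM, ImM).

Lemma Re_sum (I : Type) (r : seq I) (f : I -> R[i]) :
  Re (\sum_(i <- r) f i) = \sum_(i <- r) Re (f i).
Proof. exact: (big_morph _ ReD). Qed.

Lemma Im_sum (I : Type) (r : seq I) (f : I -> R[i]) :
  Im (\sum_(i <- r) f i) = \sum_(i <- r) Im (f i).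
Proof. exact: (big_morph _ ImD). Qed.

Lemma cmod_sqr z : cmod z ^+ 2 = Re z ^+ 2 + Im z ^+ 2.
Proof. by case: z => a b; rewrite /cmod /= sqr_sqrtr// addr_ge0 ?sqr_ge0. Qed.

Lemma cmod_ge0 z : 0 <= cmod z.
Proof. by case: z => a b; exact: sqrtr_ge0. Qed.

Lemma cmod0 : cmod (0 : R[i]) = 0.
Proof. exact: Normc.normc0. Qed.

Lemma cmod1 : cmod (1 : R[i]) = 1.
Proof. exact: Normc.normc1. Qed.

Lemma cmodM z w : cmod (z * w) = cmod z * cmod w.
Proof. exact: Normc.normcM. Qed.

Lemma cmodX z n : cmod (z ^+ n) = cmod z ^+ n.
Proof. by elim: n => [|n IH]; rewrite ?expr0 ?cmod1// !exprS cmodM IH. Qed.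

Lemma cmodV z : cmod z^-1 = (cmod z)^-1.
Proof. exact: Normc.normcV. Qed.

Lemma ler_cmodD z w : cmod (z + w) <= cmod z + cmod w.
Proof. exact: le_normcD. Qed.

Lemma cmodN z : cmod (- z) = cmod z.
Proof. exact: normcN. Qed.

Lemma cmodB z w : cmod (z - w) = cmod (w - z).
Proof. by rewrite -cmodN opprB. Qed.

Lemma cmod_eq0 z : (cmod z == 0) = (z == 0).
Proof.
by apply/eqP/eqP => [|->]; [exact: Normc.eq0_normc|exact: Normc.normc0].
Qed.

Lemma cmod_gt0 z : (0 < cmod z) = (z != 0).
Proof. by rewrite lt_neqAle cmod_ge0 andbT eq_sym cmod_eq0. Qed.

Lemma ler_sqr_cmod z (a : R) :
  0 <= a -> Re z ^+ 2 + Im z ^+ 2 <= a ^+ 2 -> cmod z <= a.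
Proof.
move=> a0; rewrite -cmod_sqr => h.
by rewrite -(@ler_pXn2r _ 2) // ?nnegrE ?cmod_ge0.
Qed.

Lemma cmod_ge_Re z : `|Re z| <= cmod z.
Proof.
rewrite -(@ler_pXn2r _ 2) // ?nnegrE ?cmod_ge0 ?normr_ge0//.
by rewrite cmod_sqr real_normK ?num_real// lerDl sqr_ge0.
Qed.

Lemma cmod_ge_Im z : `|Im z| <= cmod z.
Proof.
rewrite -(@ler_pXn2r _ 2) // ?nnegrE ?cmod_ge0 ?normr_ge0//.
by rewrite cmod_sqr real_normK ?num_real// lerDr sqr_ge0.
Qed.

Lemma Re_le_cmod z : Re z <= cmod z.
Proof. exact: le_trans (ler_norm _) (cmod_ge_Re z). Qed.

Lemma cmod_le_ReIm z : cmod z <= `|Re z| + `|Im z|.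
Proof.
apply: ler_sqr_cmod; first by rewrite addr_ge0.
rewrite -(real_normK (num_real (Re z))) -(real_normK (num_real (Im z))).
by rewrite sqrrD lerD2r lerDl mulrn_wge0// mulr_ge0.
Qed.

Lemma cmod_real (x : R) : cmod x%:C = `|x|.
Proof. by rewrite /cmod /= expr0n/= addr0 sqrtr_sqr. Qed.

Lemma cmod_sum (I : Type) (r : seq I) (f : I -> R[i]) :
  cmod (\sum_(i <- r) f i) <= \sum_(i <- r) cmod (f i).
Proof.
elim/big_rec2 : _ => [|i a b _ h]; first by rewrite cmod0.
by apply: (le_trans (ler_cmodD _ _)); rewrite lerD2l.
Qed.

End Modulus.

Section Series.
Variable R : realType.
Local Open Scope complex_scope.
Implicit Types f g : nat -> R[i].

(** The series of general term [f] is absolutely convergent, with [M] a bound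
    on the partial sums of the moduli. *)
Definition abs_summable f (M : R) := forall K, \sum_(k < K) cmod (f k) <= M.

(** Sum of an absolutely convergent series, taken componentwise. *)
Definition csum f : R[i] :=
  limn (series (fun k => Re (f k))) +i* limn (series (fun k => Im (f k))).

Lemma abs_summable_cvg (u : nat -> R) (M : R) :
  (forall K, \sum_(k < K) `|u k| <= M) ->
  forall e : R, 0 < e ->
  \forall K \near \oo, `|limn (series u) - \sum_(k < K) u k| <= e.
Proof.
move=> uM e e0.
have cu : cvgn (series u).
  apply: normed_cvg; apply: nondecreasing_is_cvgn.
    by apply: nondecreasing_series => n _ _; exact: normr_ge0.
  by exists M => _ [K _ <-]; rewrite /= seriesEord; exact: uM.
move/cvgrPdist_le : cu => /(_ e e0); apply: filterS => K.
by rewrite seriesEord.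
Qed.

Lemma csum_cvg f M : abs_summable f M -> forall e : R, 0 < e ->
  \forall K \near \oo, cmod (csum f - \sum_(k < K) f k) <= e.
Proof.
move=> fM e e0; have e20 : 0 < e / 2 by rewrite divr_gt0.
have hR : forall K, \sum_(k < K) `|Re (f k)| <= M.
  by move=> K; apply: le_trans (fM K); apply: ler_sum => k _; exact: cmod_ge_Re.
have hI : forall K, \sum_(k < K) `|Im (f k)| <= M.
  by move=> K; apply: le_trans (fM K); apply: ler_sum => k _; exact: cmod_ge_Im.
near=> K; apply: (le_trans (cmod_le_ReIm _)).
rewrite (splitr e) !ReImE Re_sum Im_sum; apply: lerD; near: K.
  exact: (abs_summable_cvg hR).
exact: (abs_summable_cvg hI).
Unshelve. all: by end_near. Qed.

Lemma csum_unique f M l : abs_summable f M ->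
  (forall e : R, 0 < e -> \forall K \near \oo, cmod (l - \sum_(k < K) f k) <= e) ->
  l = csum f.
Proof.
move=> fM hl; apply/eqP; rewrite -subr_eq0 -cmod_eq0 eq_le cmod_ge0 andbT.
apply/ler_addgt0Pl => e e0; rewrite addr0.
have e20 : 0 < e / 2 by rewrite divr_gt0.
have [K _ hK] := filterI (hl _ e20) (csum_cvg fM e20).
have [h1 h2] := hK K (leqnn K).
rewrite (_ : l - _ = (l - \sum_(k < K) f k) - (csum f - \sum_(k < K) f k));
  last by ring.
by rewrite (splitr e) (le_trans (ler_cmodD _ _))// cmodN lerD.
Qed.

Lemma csum_norm f M : abs_summable f M -> cmod (csum f) <= M.
Proof.
move=> fM; apply/ler_addgt0Pl => e e0.
have [K _ /(_ K (leqnn K)) hK] := csum_cvg fM e0.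
rewrite -(subrK (\sum_(k < K) f k) (csum f)).
apply: (le_trans (ler_cmodD _ _)); rewrite lerD//.
by apply: (le_trans (cmod_sum _ _)); exact: fM.
Qed.

Lemma abs_summableD f g M N : abs_summable f M -> abs_summable g N ->
  abs_summable (fun k => f k + g k) (M + N).
Proof.
move=> fM gN K; apply: le_trans (lerD (fM K) (gN K)).
by rewrite -big_split; apply: ler_sum => k _; exact: ler_cmodD.
Qed.

Lemma abs_summableZ f M u : abs_summable f M ->
  abs_summable (fun k => u * f k) (cmod u * M).
Proof.
move=> fM K; apply: le_trans (ler_wpM2l (cmod_ge0 u) (fM K)).
by rewrite mulr_sumr; apply: ler_sum => k _; rewrite cmodM.
Qed.

Lemma csumD f g M N : abs_summable f M -> abs_summable g N ->
  csum (fun k => f k + g k) = csum f + csum g.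
Proof.
move=> fM gN; apply/esym/(csum_unique (abs_summableD fM gN)) => e e0.
have e20 : 0 < e / 2 by rewrite divr_gt0.
apply: filterS2 (csum_cvg fM e20) (csum_cvg gN e20) => K h1 h2.
rewrite big_split/= opprD addrACA (splitr e).
by rewrite (le_trans (ler_cmodD _ _))// lerD.
Qed.

Lemma csumZ f M u : abs_summable f M ->
  csum (fun k => u * f k) = u * csum f.
Proof.
move=> fM; apply/esym/(csum_unique (abs_summableZ u fM)) => e e0.
have u1 : 0 < cmod u + 1 by rewrite ltr_wpDl ?cmod_ge0.
apply: filterS (csum_cvg fM (divr_gt0 e0 u1)) => K hK.
rewrite -mulr_sumr -mulrBr cmodM.
apply: (le_trans (ler_wpM2l (cmod_ge0 u) hK)).
by rewrite mulrCA ler_piMr ?(ltW e0)// ler_pdivrMr// mul1r lerDl.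
Qed.

Lemma abs_summableN f M : abs_summable f M -> abs_summable (fun k => - f k) M.
Proof.
by move=> fM K; apply: le_trans (fM K); under eq_bigr do rewrite cmodN.
Qed.

Lemma abs_summableB f g M N : abs_summable f M -> abs_summable g N ->
  abs_summable (fun k => f k - g k) (M + N).
Proof. by move=> fM gN; exact: (abs_summableD fM (abs_summableN gN)). Qed.

Lemma csumB f g M N : abs_summable f M -> abs_summable g N ->
  csum (fun k => f k - g k) = csum f - csum g.
Proof.
move=> fM gN; rewrite (csumD fM (abs_summableN gN)) -[in RHS]mulN1r.
rewrite -(csumZ (-1) gN); congr (_ + csum _).
by apply/funext => k; rewrite mulN1r.
Qed.

(** First-order expansions can be summed term by term. *)
Lemma csum_expansion f g h u M N P Q :
  abs_summable f M -> abs_summable g N -> abs_summable h P ->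
  abs_summable (fun k => f k - g k - u * h k) Q ->
  cmod (csum f - csum g - u * csum h) <= Q.
Proof.
move=> fM gN hP hQ; apply: le_trans (csum_norm hQ).
have hP' := abs_summableZ u hP.
rewrite -(csumZ u hP) -(csumB fM gN).
by rewrite -(csumB (abs_summableB fM gN) hP').
Qed.

Lemma csum_ge_Re f M K : abs_summable f M -> (forall k, 0 <= Re (f k)) ->
  \sum_(k < K) Re (f k) <= Re (csum f).
Proof.
move=> fM f0; apply/ler_addgt0Pl => e e0.
have [K1 _ hK] := csum_cvg fM e0.
move/(_ _ (leq_maxr K K1)) : hK => /(le_trans (cmod_ge_Re _)).
rewrite ReD ReN Re_sum => hK; rewrite -lerBlDl.
have : \sum_(k < K) Re (f k) <= \sum_(k < maxn K K1) Re (f k).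
  rewrite -(subnKC (leq_maxl K K1)) big_split_ord/= lerDl.
  by apply: sumr_ge0 => i _; exact: f0.
by move: hK; rewrite ler_norml => /andP[]; lra.
Qed.

Lemma csum_le_Im f M B : abs_summable f M ->
  (forall K, \sum_(k < K) `|Im (f k)| <= B) -> `|Im (csum f)| <= B.
Proof.
move=> fM fB; apply/ler_addgt0Pl => e e0.
have [K _ /(_ K (leqnn K))] := csum_cvg fM e0.
move=> /(le_trans (cmod_ge_Im _)); rewrite ImD ImN Im_sum => hK.
rewrite -(subrK (\sum_(k < K) Im (f k)) (Im _)).
rewrite (le_trans (ler_normD _ _))// lerD//.
by rewrite (le_trans (ler_norm_sum _ _ _)).
Qed.

End Series.

Arguments csum {R} f : simpl never.

(** * Complex differentiability *)

Section Differentiability.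
Variable R : realType.
Local Open Scope complex_scope.
Implicit Types (f g : R[i] -> R[i]) (z u l : R[i]).

(** [l] is the complex derivative of [f] at [z]. *)
Definition cdiff f z l := forall e : R, 0 < e ->
  exists2 d : R, 0 < d & forall u, cmod u < d ->
    cmod (f (z + u) - f z - u * l) <= e * cmod u.

(** A quadratic remainder is enough for differentiability. *)
Lemma cdiff_quad f z l (rho M : R) : 0 < rho ->
  (forall u, cmod u < rho -> cmod (f (z + u) - f z - u * l) <= M * cmod u ^+ 2) ->
  cdiff f z l.
Proof.
move=> rho0 fM e e0.
have M1 : 0 < `|M| + 1 by rewrite ltr_wpDl.
exists (Num.min rho (e / (`|M| + 1))); first by rewrite lt_min rho0 divr_gt0.
move=> u; rewrite lt_min ltr_pdivlMr// => /andP[/fM h1 h2].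
apply: (le_trans h1); rewrite expr2 mulrA ler_wpM2r ?cmod_ge0//.
by have := ler_norm M; have := cmod_ge0 u; nra.
Qed.

Lemma cdiff_cont f z l : cdiff f z l -> forall e : R, 0 < e ->
  exists2 d : R, 0 < d & forall u, cmod u < d -> cmod (f (z + u) - f z) <= e.
Proof.
move=> fl e e0; have [d d0 hd] := fl _ ltr01.
have c1 : 0 < 1 + cmod l by rewrite ltr_wpDr ?cmod_ge0.
exists (Num.min d (e / (1 + cmod l))); first by rewrite lt_min d0 divr_gt0.
move=> u; rewrite lt_min ltr_pdivlMr// => /andP[/hd h1 h2].
rewrite -(subrK (u * l) (_ - f z)); apply: (le_trans (ler_cmodD _ _)).
by rewrite cmodM; nra.
Qed.

Lemma cdiff_comp f g z l m : cdiff f z l -> cdiff g (f z) m ->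
  cdiff (g \o f) z (l * m).
Proof.
move=> fl gm e e0.
have c1 : 0 < 2 + cmod l + cmod m.
  by have := cmod_ge0 l; have := cmod_ge0 m; lra.
pose e1 := Num.min 1 (e / (2 + cmod l + cmod m)).
have e10 : 0 < e1 by rewrite lt_min ltr01 divr_gt0.
have e11 : e1 <= 1 by rewrite ge_min lexx.
have e1e : e1 * (2 + cmod l + cmod m) <= e.
  by rewrite -ler_pdivlMr// ge_min lexx orbT.
have [d d0 hd] := fl _ e10; have [d' d'0 hd'] := gm _ e10.
have d'2 : 0 < d' / 2 by rewrite divr_gt0.
have [d2 d20 hd2] := cdiff_cont fl d'2.
exists (Num.min d d2); first by rewrite lt_min d0.
move=> u; rewrite lt_min => /andP[/hd h1 /hd2 h2] /=.
pose v := f (z + u) - f z.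
have vd : cmod v < d' by apply: (le_lt_trans h2); lra.
have := hd' _ vd; have -> : f z + v = f (z + u) by rewrite /v; ring.
move=> h3.
have vu : cmod v <= (1 + cmod l) * cmod u.
  rewrite -(subrK (u * l) v); apply: (le_trans (ler_cmodD _ _)).
  rewrite cmodM /v; have := cmod_ge0 u; nra.
rewrite (_ : _ - _ = (g (f (z + u)) - g (f z) - v * m) + (v - u * l) * m); last by ring.
apply: (le_trans (ler_cmodD _ _)); rewrite cmodM.
apply: (@le_trans _ _ (e1 * ((1 + cmod l) * cmod u) + e1 * cmod u * cmod m)).
  apply: lerD; first by apply: (le_trans h3); rewrite ler_wpM2l// ltW.
  by rewrite ler_wpM2r ?cmod_ge0.
have := cmod_ge0 u; have := cmod_ge0 m; have := cmod_ge0 l; nra.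
Qed.

Lemma cdiff_scale (c : R[i]) z : cdiff (fun w => c * w) z c.
Proof.
apply: (@cdiff_quad _ _ _ 1 0) => // u _.
by rewrite (_ : _ - _ = 0) ?cmod0 ?mul0r//; ring.
Qed.

Lemma cdiff_near f g z l (rho : R) : 0 < rho ->
  (forall u, cmod u < rho -> f (z + u) = g (z + u)) ->
  cdiff g z l -> cdiff f z l.
Proof.
move=> rho0 fg gl e e0; have [d d0 hd] := gl e e0.
exists (Num.min d rho); first by rewrite lt_min d0.
move=> u; rewrite lt_min => /andP[/hd h1 /fg ->].
by have := fg 0; rewrite addr0 cmod0 => ->.
Qed.

Lemma cdiff_derivable f z l : cdiff f z l -> derivable f z 1.
Proof.
move=> fl; apply/cvg_ex; exists l; apply/cvgrPdist_le => /= e e0.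
have [ee e0'] : (Re e)%:C = e /\ 0 < Re e.
  by move: e0; case: e => a b; rewrite ltcE/= => /andP[/eqP -> ->].
have [d d0 hd] := fl _ e0'.
near=> u.
have u0 : u != 0 by near: u; exact: nbhs_dnbhs_neq.
have ud : cmod u < d.
  rewrite -ltcR -normrE; near: u; apply: dnbhs0_lt; rewrite ltcR//.
rewrite normrE -ee lecR scaler1.
have := hd _ ud; rewrite -ler_pdivrMr ?cmod_gt0//; apply: le_trans.
rewrite -cmodV -cmodM /= (addrC u z).
rewrite (_ : l - _ = - ((f (z + u) - f z - u * l) / u)) ?cmodN//.
rewrite -[u^-1 *: _]/(u^-1 * _); field. 
exact: u0.
Unshelve. all: by end_near. Qed.

End Differentiability.

(** * A logarithm-like function of the right half-plane *)

Section Telescoping.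
Variable R : realType.

Lemma ler_sum_telescope (a b : nat -> R) :
  (forall k, a k <= b k - b k.+1) -> forall K, \sum_(k < K) a k <= b 0%N - b K.
Proof.
move=> ab; elim=> [|K IH]; first by rewrite big_ord0 subrr.
by rewrite big_ord_recr/= (le_trans (lerD IH (ab K)))// addrA subrK.
Qed.

Lemma sum_inv_sqr_le2 K : \sum_(k < K) (k.+1%:R ^- 2 : R) <= 2.
Proof.
pose b k : R := 2 / k.+1%:R.
have b0 k : 0 <= b k by rewrite divr_ge0.
apply: (le_trans (@ler_sum_telescope (fun k => k.+1%:R ^- 2) b _ K)); last first.
  by rewrite {1}/b divr1 lerBlDr lerDl.
move=> k; rewrite /b -subr_ge0.
have p1 : (k.+1%:R : R) != 0 by rewrite pnatr_eq0.
have p2 : (k.+2%:R : R) != 0 by rewrite pnatr_eq0.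
have q2 : (k.+2%:R : R) = k.+1%:R + 1 by rewrite -natr1.
have q1 : 1 <= (k.+1%:R : R) by rewrite ler1n.
rewrite (_ : _ - _ = k%:R * (k.+1%:R ^- 2 * k.+2%:R ^-1)).
  by rewrite !mulr_ge0// invr_ge0 exprn_ge0.
have q0 : (k.+1%:R : R) = k%:R + 1 by rewrite -natr1.
rewrite q2 q0; field.
by rewrite -!natr1 in p1 p2; rewrite p1 p2.
Qed.

End Telescoping.

Section Dig.
Variable R : realType.
Local Open Scope complex_scope.
Implicit Types (z u : R[i]) (k K : nat).

Definition dig_term z k : R[i] :=
  (k.+1%:R^-1 : R)%:C - (z + (k.+1%:R : R)%:C)^-1.

(** [dig z = \sum_(n >= 1) (1 / n - 1 / (z + n))], the digamma function up to
    a shift of its argument and an additive constant. On the right half-plane it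
    behaves like the logarithm: it is holomorphic, its imaginary part is bounded,
    and tends to zero if [z] tends to infinity with a bounded imaginary part, and
    its real part is nonnegative and tends to infinity with that of [z]. *)
Definition dig z : R[i] := csum (dig_term z).

Lemma shift_ge z k : - 2^-1 <= Re z ->
  k.+1%:R / 2 <= cmod (z + (k.+1%:R : R)%:C).
Proof.
move=> hz; apply: le_trans (Re_le_cmod _); rewrite ReD /=.
have : 1 <= (k.+1%:R : R) by rewrite ler1n.
lra.
Qed.

Lemma shift_gt0 z k : - 2^-1 <= Re z -> 0 < cmod (z + (k.+1%:R : R)%:C).
Proof. by move=> /(shift_ge k); apply: lt_le_trans; rewrite divr_gt0. Qed.

Lemma real_complex_neq0 k : ((k.+1%:R : R)%:C : R[i]) != 0.
Proof. by rewrite -cmod_eq0 cmod_real normr_eq0 pnatr_eq0. Qed.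

Lemma dig_termE z k : - 2^-1 <= Re z ->
  dig_term z k = z / ((k.+1%:R : R)%:C * (z + (k.+1%:R : R)%:C)).
Proof.
move=> /(shift_gt0 k); rewrite cmod_gt0 => h; rewrite /dig_term fmorphV/=.
have := real_complex_neq0 k; move: h; move: (_%:C) => n h1 h2.
by field; rewrite h1 h2.
Qed.

Lemma dig_summable z : - 2^-1 <= Re z ->
  abs_summable (dig_term z) (4 * cmod z).
Proof.
move=> hz K.
rewrite (_ : 4 * cmod z = (2 * cmod z) * 2); last by ring.
apply: le_trans (ler_wpM2l _ (sum_inv_sqr_le2 R K)); last first.
  by rewrite mulr_ge0 ?cmod_ge0.
rewrite mulr_sumr; apply: ler_sum => k _.
rewrite dig_termE// cmodM cmodV cmodM cmod_real ger0_norm//.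
have h := shift_ge k hz; have g := shift_gt0 k hz.
have k0 : 0 < (k.+1%:R : R) by rewrite ltr0n.
rewrite ler_pdivrMr ?mulr_gt0//; move: (cmod (z + _)) h => c h.
rewrite (_ : _ * (_ * c) = cmod z * (2 * c / k.+1%:R)).
  by rewrite ler_peMr ?cmod_ge0// ler_pdivlMr// mul1r; lra.
by field; rewrite gt_eqF//; lra.
Qed.

Lemma dig_der_summable z : 0 <= Re z ->
  abs_summable (fun k => (z + (k.+1%:R : R)%:C) ^- 2) 2.
Proof.
move=> hz K; apply: le_trans (sum_inv_sqr_le2 R K); apply: ler_sum => k _.
rewrite cmodV cmodX lef_pV2 ?posrE ?exprn_gt0//; last first.
  by apply: shift_gt0; apply: le_trans hz; rewrite oppr_le0.
rewrite lerXn2r// ?nnegrE ?cmod_ge0//.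
by apply: le_trans (Re_le_cmod _); rewrite ReD/= lerDr.
Qed.

Lemma dig_cdiff z : 0 <= Re z ->
  cdiff dig z (csum (fun k => (z + (k.+1%:R : R)%:C) ^- 2)).
Proof.
move=> hz; have hz' : - 2^-1 <= Re z by apply: le_trans hz; rewrite oppr_le0.
apply: (@cdiff_quad _ _ _ _ 2^-1 4) => [//|u hu].
have hzu : - 2^-1 <= Re (z + u).
  rewrite ReD; have := le_lt_trans (cmod_ge_Re u) hu.
  by rewrite ltr_norml => /andP[]; lra.
apply: (csum_expansion (dig_summable hzu) (dig_summable hz') (dig_der_summable hz)).
move=> K.
rewrite (_ : 4 * _ = (2 * cmod u ^+ 2) * 2); last by ring.
apply: le_trans (ler_wpM2l _ (sum_inv_sqr_le2 R K)); last first.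
  by rewrite mulr_ge0 ?sqr_ge0.
rewrite mulr_sumr; apply: ler_sum => k _.
have h := shift_ge k hzu; have g := shift_gt0 k hzu; have g' := shift_gt0 k hz'.
have k0 : 1 <= (k.+1%:R : R) by rewrite ler1n.
have h' : k.+1%:R <= cmod (z + (k.+1%:R : R)%:C).
  by apply: le_trans (Re_le_cmod _); rewrite ReD/= lerDr.
rewrite /dig_term (_ : _ - _ = - u ^+ 2 /
  ((z + (k.+1%:R : R)%:C) ^+ 2 * (z + u + (k.+1%:R : R)%:C))); last first.
  move: g g'; rewrite !cmod_gt0; move: ((k.+1%:R^-1 : R)%:C) => c.
  by move: (k.+1%:R%:C) => n g1 g2; field; rewrite g1 g2.
rewrite cmodM cmodV cmodM cmodN !cmodX ler_pdivrMr ?mulr_gt0 ?exprn_gt0//.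
move: (cmod (z + _)) (cmod (z + u + _)) h h' {g g'} => A B h h'.
have k1 : (k.+1%:R : R) != 0 by rewrite pnatr_eq0.
rewrite (_ : _ * (_ * B) = cmod u ^+ 2 * (2 * B * (A / k.+1%:R) ^+ 2)); last first.
  by move: k1 => {h h' k0}; move: (k.+1%:R : R) => n n0; field.
rewrite ler_peMr ?sqr_ge0// -[1]mulr1 ler_pM//; first by lra.
by rewrite expr_ge1// ler_pdivlMr ?mul1r//; lra.
Qed.

Lemma dig_term_Re z k : Re (dig_term z k) =
  k.+1%:R^-1 - (Re z + k.+1%:R) / ((Re z + k.+1%:R) ^+ 2 + Im z ^+ 2).
Proof. by rewrite /dig_term ReD ReN ReV ReD ImD /= addr0. Qed.

Lemma dig_term_Im z k : Im (dig_term z k) =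
  Im z / ((Re z + k.+1%:R) ^+ 2 + Im z ^+ 2).
Proof.
by rewrite /dig_term ImD ImN ImV ReD ImD /= addr0 add0r mulNr opprK.
Qed.

Lemma dig_term_ge_Re z k : 0 <= Re z ->
  k.+1%:R^-1 - (Re z + k.+1%:R)^-1 <= Re (dig_term z k).
Proof.
move=> z0; rewrite dig_term_Re lerD2l lerN2.
have k0 : 1 <= (k.+1%:R : R) by rewrite ler1n.
move: (k.+1%:R : R) k0 => n n1; have a0 : 0 < Re z + n by lra.
rewrite ler_pdivrMr; last by rewrite ltr_wpDr ?sqr_ge0 ?exprn_gt0.
by rewrite mulrDr expr2 mulKf ?gt_eqF// lerDl mulr_ge0 ?sqr_ge0// invr_ge0 ltW.
Qed.

Lemma dig_term_Re_ge0 z k : 0 <= Re z -> 0 <= Re (dig_term z k).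
Proof.
move=> z0; apply: le_trans (dig_term_ge_Re k z0).
rewrite subr_ge0 lef_pV2 ?posrE ?lerDr//.
by rewrite ltr_wpDl.
Qed.

Lemma half_le_Re z : 0 <= Re z -> - 2^-1 <= Re z.
Proof. by apply: le_trans; rewrite oppr_le0. Qed.

Lemma dig_Re_ge0 z : 0 <= Re z -> 0 <= Re (dig z).
Proof.
move=> z0.
have := csum_ge_Re 0%N (dig_summable (half_le_Re z0))
  (fun k => dig_term_Re_ge0 k z0).
by rewrite big_ord0.
Qed.

Lemma dig_Im_le2 z : 0 <= Re z -> `|Im (dig z)| <= 2.
Proof.
move=> z0; apply: (csum_le_Im (dig_summable (half_le_Re z0))) => K.
pose y : R := `|Im z|.
have y0 : 0 <= y by exact: normr_ge0.
(* The terms are at most [y / (n ^ 2 + y ^ 2)], which is at most twice the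
   increment of [n / (n + y)] from [n - 1] to [n]. *)
pose b (k : nat) : R := - 2 * (k%:R / (k%:R + y)).
have b0 k : - 2 <= b k.
  rewrite /b mulNr lerN2 ler_piMr//.
  have [|h] := ltP 0 (k%:R + y).
    by move=> h; rewrite ler_pdivrMr// mul1r lerDl.
  rewrite (_ : k%:R + y = 0) ?invr0 ?mulr0//.
  by apply/eqP; rewrite eq_le h addr_ge0.
apply: (le_trans (@ler_sum_telescope _ (fun k => `|Im (dig_term z k)|) b _ K));
  last first.
  by rewrite {1}/b mul0r mulr0 sub0r lerNl.
move=> k; rewrite dig_term_Im.
have [y00|yn0] := eqVneq (Im z) 0.
  have h1 : (k.+1%:R : R) / k.+1%:R = 1 by rewrite divff ?pnatr_eq0.
  have h2 : (k%:R : R) / k%:R <= 1.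
    by case: (k) => [|m]; rewrite ?mulr0n ?mul0r// divff ?pnatr_eq0.
  by rewrite /b /y y00 mul0r normr0 !addr0 h1; lra.
have y1 : 0 < y by rewrite normr_gt0.
rewrite normrM normfV.
rewrite /b; have -> : (k.+1%:R : R) = k%:R + 1 by rewrite -natr1.
have k0 : 0 <= (k%:R : R) by [].
have -> : Im z ^+ 2 = y ^+ 2 by rewrite real_normK ?num_real.
move: (k%:R : R) k0 => n n0.
rewrite -/y ger0_norm; last by rewrite addr_ge0 ?sqr_ge0.
rewrite (_ : - 2 * _ - _ = 2 * y / ((n + y) * (n + 1 + y))); last first.
  by field; rewrite !gt_eqF//; lra.
rewrite ler_pdivrMr; last by rewrite ltr_wpDl ?sqr_ge0 ?exprn_gt0.
rewrite mulrAC ler_pdivlMr; last by rewrite mulr_gt0//; lra.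
rewrite [2 * y]mulrC -mulrA ler_pM2l//.
move: (Re z) z0 => x x0; have := sqr_ge0 (n + 1 - y).
have : 0 <= x * (x + 2 * (n + 1)) by rewrite mulr_ge0//; lra.
by nra.
Qed.

Lemma dig_Im_small z : 0 < Re z -> `|Im (dig z)| <= `|Im z| / Re z.
Proof.
move=> z0; apply: (csum_le_Im (dig_summable (half_le_Re (ltW z0)))) => K.
(* The terms are at most [|y| / (x + n) ^ 2], which is at most the decrement of
   [|y| / (x + n)] from [n - 1] to [n]. *)
pose b (k : nat) : R := `|Im z| / (Re z + k%:R).
have b0 k : 0 <= b k by rewrite divr_ge0// addr_ge0// ltW.
apply: (le_trans (@ler_sum_telescope _ (fun k => `|Im (dig_term z k)|) b _ K));
  last first.
  by rewrite {1}/b addr0 lerBlDr lerDl.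
move=> k; rewrite dig_term_Im normrM normfV /b -mulrBr ler_wpM2l//.
have -> : (k.+1%:R : R) = k%:R + 1 by rewrite -natr1.
have k0 : 0 <= (k%:R : R) by [].
move: (k%:R : R) k0 => n n0; move: (Re z) (Im z) z0 => x y x0.
rewrite ger0_norm; last by rewrite addr_ge0 ?sqr_ge0.
rewrite (_ : _ - _ = ((x + n) * (x + (n + 1)))^-1); last first.
  by field; rewrite !gt_eqF//; lra.
rewrite lef_pV2 ?posrE; first by have := sqr_ge0 y; nra.
  by rewrite ltr_wpDr ?sqr_ge0 ?exprn_gt0//; lra.
by rewrite mulr_gt0//; lra.
Qed.

Lemma dig_Re_unbounded (M : R) :
  exists2 A : R, 0 < A & forall z, A <= Re z -> M <= Re (dig z).
Proof.
have [K hK] : exists K, M + 1 <= series (@harmonic R) K.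
  apply: contrapT => /forallNP h; apply: (@dvg_harmonic R).
  apply: nondecreasing_is_cvgn.
    by apply: nondecreasing_series => n _ _; exact: harmonic_ge0.
  by exists (M + 1) => _ [K _ <-]; apply: ltW; rewrite ltNge; apply/negP.
exists K.+1%:R => // z hz.
have z0 : 0 < Re z by apply: lt_le_trans hz.
apply: le_trans (@csum_ge_Re _ _ _ K (dig_summable (half_le_Re (ltW z0))) _);
  last first.
  by move=> k; apply/dig_term_Re_ge0/ltW.
have h : \sum_(k < K) (k.+1%:R^-1 - (Re z)^-1) <= \sum_(k < K) Re (dig_term z k).
  apply: ler_sum => k _; apply: le_trans (dig_term_ge_Re k (ltW z0)).
  rewrite lerD2l lerN2 lef_pV2 ?posrE ?lerDl//.
  by rewrite ltr_wpDr.
apply: le_trans h; rewrite sumrB lerBrDr.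
move: hK; rewrite seriesEord /= => /(le_trans _); apply.
rewrite lerD2l sumr_const card_ord -mulr_natl ler_pdivrMr// mul1r.
by apply: le_trans hz; rewrite ler_nat.
Qed.

End Dig.

(** * A holomorphic function with infinite radial limits on a null set *)

Section Pole.
Variable R : realType.
Local Open Scope complex_scope.
Implicit Types (alpha w z u : R[i]) (d r : R).

(** For [alpha] the conjugate of a point [w] of the unit circle, this function
    has its pole at [(1 + d) w], at distance [d] from the circle. Its modulus at
    [z] is at most [d / (1 - |z|)], its real part is nonnegative on the disc, and
    at least [1/9] close to [w] at scale [d]. *)
Definition pole alpha d z : R[i] := d%:C / ((1 + d)%:C - alpha * z).

Lemma ler_cmod1M alpha z : cmod alpha <= 1 -> cmod (alpha * z) <= cmod z.
Proof. by move=> a1; rewrite cmodM ler_piMl ?cmod_ge0. Qed.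

Lemma pole_den_Re alpha d z : cmod alpha <= 1 ->
  d + (1 - cmod z) <= Re ((1 + d)%:C - alpha * z).
Proof.
move=> a1; rewrite ReD ReN /=.
by have := Re_le_cmod (alpha * z); have := ler_cmod1M z a1; lra.
Qed.

Lemma pole_den_cmod alpha d z : cmod alpha <= 1 -> 0 <= d ->
  1 - cmod z <= cmod ((1 + d)%:C - alpha * z).
Proof.
by move=> a1 d0; apply: le_trans (Re_le_cmod _); have := pole_den_Re d z a1; lra.
Qed.

Lemma pole_cmod alpha d z : cmod alpha <= 1 -> 0 <= d -> cmod z < 1 ->
  cmod (pole alpha d z) <= d / (1 - cmod z).
Proof.
move=> a1 d0 z1; rewrite cmodM cmodV cmod_real ger0_norm// ler_wpM2l//.
have h := pole_den_cmod z a1 d0.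
by rewrite lef_pV2 ?posrE ?subr_gt0// (lt_le_trans _ h) ?subr_gt0.
Qed.

Lemma pole_Re alpha d z : Re (pole alpha d z) =
  d * Re ((1 + d)%:C - alpha * z) / cmod ((1 + d)%:C - alpha * z) ^+ 2.
Proof. by rewrite /pole ReM ReV /= mul0r subr0 mulrA cmod_sqr. Qed.

Lemma pole_Re_ge0 alpha d z : cmod alpha <= 1 -> 0 <= d -> cmod z < 1 ->
  0 <= Re (pole alpha d z).
Proof.
move=> a1 d0 z1; rewrite pole_Re divr_ge0 ?sqr_ge0// mulr_ge0//.
by have := pole_den_Re d z a1; lra.
Qed.

Lemma pole_expansion alpha d z u : cmod alpha <= 1 -> 0 <= d -> cmod z < 1 ->
  cmod u < (1 - cmod z) / 2 ->
  cmod (pole alpha d (z + u) - pole alpha d z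
    - u * (d%:C * alpha / ((1 + d)%:C - alpha * z) ^+ 2))
  <= d * (2 * cmod u ^+ 2 / (1 - cmod z) ^+ 3).
Proof.
move=> a1 d0 z1 hu; pose s : R := 1 - cmod z; have s0 : 0 < s by rewrite subr_gt0.
have h1 := pole_den_cmod z a1 d0.
have h2 : s / 2 <= cmod ((1 + d)%:C - alpha * (z + u)).
  apply: le_trans (pole_den_cmod (z + u) a1 d0).
  by have := ler_cmodD z u; rewrite /s; lra.
rewrite /pole.
have E : (1 + d)%:C - alpha * (z + u) = (1 + d)%:C - alpha * z - alpha * u by ring.
rewrite E in h2 *; rewrite -/s in h1 *.
move: ((1 + d)%:C - alpha * z) h1 h2 => D h1 h2.
have p1 : 0 < cmod D by apply: lt_le_trans h1.
have p2 : 0 < cmod (D - alpha * u) by apply: lt_le_trans h2; rewrite divr_gt0.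
rewrite (_ : _ - _ =
  d%:C * (alpha ^+ 2 * u ^+ 2 / (D ^+ 2 * (D - alpha * u)))); last first.
  move: p1 p2; rewrite !cmod_gt0; move: (d%:C) => c q1 q2.
  by field; rewrite q1 q2.
rewrite cmodM cmod_real ger0_norm// ler_wpM2l//.
rewrite !cmodM cmodV cmodM !cmodX.
rewrite ler_pdivrMr ?mulr_gt0 ?exprn_gt0//.
move: (cmod D) (cmod (D - _)) p1 p2 h1 h2 => A B p1 p2 h1 h2.
rewrite (_ : _ * (_ * B) = cmod u ^+ 2 * ((A / s) ^+ 2 * (2 * B / s))); last first.
  by move: s0 => {h1 h2 hu}; move: s => s s0; field; rewrite gt_eqF.
apply: (@le_trans _ _ (cmod u ^+ 2)).
  by rewrite ler_piMl ?mulr_ge0 ?cmod_ge0// -expr2 exprn_ile1 ?cmod_ge0.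
rewrite ler_peMr ?sqr_ge0// -[leLHS]mulr1 ler_pM//.
  have As : 1 <= A / s by rewrite ler_pdivlMr ?mul1r.
  by rewrite expr_ge1// (le_trans ler01).
by rewrite ler_pdivlMr ?mul1r//; lra.
Qed.

Lemma pole_Re_ge alpha w d r : cmod alpha <= 1 -> cmod w = 1 -> 0 < d ->
  cmod (1 - alpha * w) <= d -> 0 <= r < 1 -> 1 - r <= d ->
  9^-1 <= Re (pole alpha d (r%:C * w)).
Proof.
move=> a1 w1 d0 aw /andP[r0 r1] rd.
have z1 : cmod (r%:C * w) = r by rewrite cmodM w1 mulr1 cmod_real ger0_norm.
have h1 := pole_den_Re d (r%:C * w) a1.
have h2 := pole_den_cmod (r%:C * w) a1 (ltW d0).
rewrite z1 in h1 h2; rewrite pole_Re.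
have h3 : cmod ((1 + d)%:C - alpha * (r%:C * w)) <= 3 * d.
  rewrite (_ : _ - _ = d%:C + (1 - alpha * w) + (1 - r)%:C * (alpha * w)); last first.
    by rewrite rmorphD rmorphB/= rmorph1; ring.
  apply: (le_trans (ler_cmodD _ _)).
  have := ler_cmodD d%:C (1 - alpha * w); rewrite cmod_real ger0_norm ?(ltW d0)//.
  rewrite [cmod (_ * (alpha * w))]cmodM cmod_real ger0_norm ?subr_ge0 ?(ltW r1)//.
  have : (1 - r) * cmod (alpha * w) <= d.
    have c1 := ler_cmod1M w a1; rewrite w1 in c1.
    by apply: le_trans rd; rewrite ler_piMr ?subr_ge0// ltW.
  by lra.
move: (cmod (_ - _)) (Re (_ - _)) h1 h2 h3 => m t h1 h2 h3.
have m0 : 0 < m by lra.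
rewrite ler_pdivlMr ?exprn_gt0// ler_pdivrMl//.
by rewrite expr2; nra.
Qed.

End Pole.

Section PoleSum.
Variable R : realType.
Local Open Scope complex_scope.
Variables (alpha : nat -> nat -> R[i]) (d : nat -> nat -> R).
Hypothesis alpha1 : forall n k, cmod (alpha n k) <= 1.
Hypothesis d0 : forall n k, 0 < d n k.
Hypothesis dsum : forall n K, \sum_(k < K) d n k <= 2^-1 ^+ n.
Implicit Types (w z u : R[i]) (n k : nat).

Let dge0 n k : 0 <= d n k. Proof. exact: ltW. Qed.

(** Sum of the poles of one row, of total size at most [2 ^ - n]. *)
Definition pole_row n z : R[i] := csum (fun k => pole (alpha n k) (d n k) z).

Definition pole_row_der n z : R[i] := csum (fun k =>
  (d n k)%:C * alpha n k / ((1 + d n k)%:C - alpha n k * z) ^+ 2).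

(** Sum of the poles of all rows. *)
Definition pole_sum z : R[i] := csum (pole_row ^~ z).

Lemma pole_row_summable n z : cmod z < 1 ->
  abs_summable (fun k => pole (alpha n k) (d n k) z) (2^-1 ^+ n / (1 - cmod z)).
Proof.
move=> z1 K; apply: (@le_trans _ _ ((\sum_(k < K) d n k) / (1 - cmod z))).
  by rewrite mulr_suml; apply: ler_sum => k _; exact: pole_cmod.
by rewrite ler_wpM2r ?dsum// invr_ge0 subr_ge0 ltW.
Qed.

Lemma pole_row_der_summable n z : cmod z < 1 ->
  abs_summable (fun k =>
    (d n k)%:C * alpha n k / ((1 + d n k)%:C - alpha n k * z) ^+ 2)
    (2^-1 ^+ n / (1 - cmod z) ^+ 2).
Proof.
move=> z1 K; have s0 : 0 < 1 - cmod z by rewrite subr_gt0.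
apply: (@le_trans _ _ ((\sum_(k < K) d n k) / (1 - cmod z) ^+ 2)); last first.
  by rewrite ler_wpM2r ?dsum// invr_ge0 exprn_ge0 ?ltW.
rewrite mulr_suml; apply: ler_sum => k _.
rewrite -mulrA cmodM cmod_real ger0_norm// ler_wpM2l//.
rewrite cmodM cmodV cmodX; have h := pole_den_cmod z (alpha1 n k) (dge0 n k).
have p : 0 < cmod ((1 + d n k)%:C - alpha n k * z) by apply: lt_le_trans h.
apply: (@le_trans _ _ (cmod ((1 + d n k)%:C - alpha n k * z) ^- 2)).
  by rewrite ler_piMl ?invr_ge0 ?exprn_ge0 ?cmod_ge0.
by rewrite lef_pV2 ?posrE ?exprn_gt0// lerXn2r// nnegrE ltW.
Qed.

Lemma sum_half (K : nat) : \sum_(n < K) 2^-1 ^+ n <= (2 : R).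
Proof.
pose b n : R := 2 * 2^-1 ^+ n.
apply: (le_trans (@ler_sum_telescope _ (fun n => 2^-1 ^+ n) b _ K)).
  by move=> n; rewrite /b exprS; have := @exprn_ge0 R n 2^-1; lra.
by rewrite /b expr0 mulr1 lerBlDr lerDl mulr_ge0// exprn_ge0.
Qed.

Lemma sum_half_le (f : nat -> R[i]) (c : R) : 0 <= c ->
  (forall n, cmod (f n) <= 2^-1 ^+ n * c) -> abs_summable f (2 * c).
Proof.
move=> c0 fc K; apply: le_trans (ler_wpM2r c0 (sum_half K)).
by rewrite mulr_suml; apply: ler_sum => n _.
Qed.

Lemma pole_sum_summable z : cmod z < 1 ->
  abs_summable (pole_row ^~ z) (2 * (1 - cmod z)^-1).
Proof.
move=> z1; apply: sum_half_le => [|n]; last exact: csum_norm (pole_row_summable _ z1).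
by rewrite invr_ge0 subr_ge0 ltW.
Qed.

Lemma pole_sum_cdiff z : cmod z < 1 -> cdiff pole_sum z (csum (pole_row_der ^~ z)).
Proof.
move=> z1; have s0 : 0 < 1 - cmod z by rewrite subr_gt0.
apply: (@cdiff_quad _ _ _ _ ((1 - cmod z) / 2) (2 * (2 / (1 - cmod z) ^+ 3))).
  by rewrite divr_gt0.
move=> u hu.
have zu1 : cmod (z + u) < 1 by have := ler_cmodD z u; lra.
rewrite -mulrA.
apply: (@csum_expansion _ _ _ (pole_row_der ^~ z) _ _ _ (2 * (1 - cmod z) ^- 2) _
  (pole_sum_summable zu1) (pole_sum_summable z1)).
  apply: sum_half_le => [|n]; first by rewrite invr_ge0 exprn_ge0 ?ltW.
  exact: csum_norm (pole_row_der_summable _ z1).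
apply: sum_half_le => [|n].
  by rewrite mulr_ge0 ?sqr_ge0// divr_ge0 ?exprn_ge0 ?ltW.
apply: (csum_expansion (pole_row_summable n zu1) (pole_row_summable n z1)
  (pole_row_der_summable n z1)) => K.
rewrite [X in _ * X]mulrAC.
apply: (@le_trans _ _
  ((\sum_(k < K) d n k) * (2 * cmod u ^+ 2 / (1 - cmod z) ^+ 3))).
  by rewrite mulr_suml; apply: ler_sum => k _; exact: pole_expansion.
by rewrite ler_wpM2r ?dsum// divr_ge0 ?mulr_ge0 ?exprn_ge0 ?cmod_ge0 ?(ltW s0).
Qed.

Lemma pole_row_Re_ge n k z : cmod z < 1 ->
  Re (pole (alpha n k) (d n k) z) <= Re (pole_row n z).
Proof.
move=> z1; have p0 j : 0 <= Re (pole (alpha n j) (d n j) z).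
  exact: pole_Re_ge0.
apply: le_trans (csum_ge_Re k.+1 (pole_row_summable n z1) p0).
by rewrite big_ord_recr/= lerDr sumr_ge0.
Qed.

Lemma pole_row_Re_ge0 n z : cmod z < 1 -> 0 <= Re (pole_row n z).
Proof.
move=> z1; apply: le_trans (pole_row_Re_ge n 0 z1).
exact: pole_Re_ge0.
Qed.

Lemma pole_sum_Re_ge0 z : cmod z < 1 -> 0 <= Re (pole_sum z).
Proof.
move=> z1; have := csum_ge_Re 0%N (pole_sum_summable z1)
  (fun n => pole_row_Re_ge0 n z1).
by rewrite big_ord0.
Qed.

(** If each row [n] has a pole at which [w] is close at scale [d n k], then it
    contributes at least [1/9] to the real part at [r w] for [r] near [1]. *)
Lemma pole_sum_radial w : cmod w = 1 ->
  (forall n, exists k, cmod (1 - alpha n k * w) <= d n k) ->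
  forall M : R, exists2 r0 : R, 0 <= r0 < 1 &
    forall r : R, r0 <= r < 1 -> M <= Re (pole_sum (r%:C * w)).
Proof.
move=> w1 /choice[k hk] M.
(* [N] rows suffice. *)
pose N := (Num.truncn (9 * `|M|)).+1.
have hN : M <= \sum_(n < N) 9^-1.
  rewrite sumr_const card_ord -[_ *+ N]mulr_natr ler_pdivlMl//.
  apply: (@le_trans _ _ (9 * `|M|)); first by rewrite ler_pM2l// ler_norm.
  by rewrite ltW// truncnS_gt.
have [r0 r01 hr0] : exists2 r0 : R, 0 <= r0 < 1 &
    forall n, (n < N)%N -> 1 - r0 <= d n (k n).
  elim: N {hN} => [|N [r0 /andP[r00 r01] hr0]]; first by exists 0; rewrite ?lexx ?ltr01.
  exists (Num.max r0 (1 - d N (k N))).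
    by rewrite le_max r00/= gt_max r01/= ltrBlDr ltrDl.
  move=> n; rewrite ltnS leq_eqVlt => /predU1P[->|/hr0 h].
    by rewrite lerBlDr -lerBlDl le_max lexx orbT.
  by apply: le_trans h; rewrite lerD2l lerN2 le_max lexx.
exists r0 => // r /andP[r0r r1].
have rr : 0 <= r < 1 by rewrite r1 andbT; case/andP: r01 => h _; exact: le_trans r0r.
have z1 : cmod (r%:C * w) < 1.
  by case/andP: rr => r00 _; rewrite cmodM w1 mulr1 cmod_real ger0_norm.
apply: le_trans (csum_ge_Re N (pole_sum_summable z1) (fun n => pole_row_Re_ge0 n z1)).
apply: (le_trans hN); apply: ler_sum => n _.
apply: le_trans (pole_row_Re_ge n (k n) z1).
by apply: pole_Re_ge => //; apply: le_trans (hr0 n (ltn_ord n)); rewrite lerD2l lerN2.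
Qed.

End PoleSum.

(** * The complex exponential *)

Section RealBounds.
Variable R : realType.
Implicit Types x t : R.

Lemma sin_mean_value t : exists2 c, `|c| <= `|t| & sin t = cos c * t.
Proof.
wlog t0 : t / 0 <= t.
  move=> H; have [|t0] := leP 0 t; first exact: H.
  have [|c ct st] := H (- t); first by rewrite oppr_ge0 ltW.
  exists c; first by rewrite normrN in ct.
  by apply: oppr_inj; rewrite -sinN st mulrN.
have cs : {within `[0, t], continuous (@sin R)}.
  by apply: continuous_subspaceT => x; exact: continuous_sin.
have [c] := MVT_segment t0 (fun x _ => is_derive_sin x) cs.
rewrite in_itv/= sin0 !subr0 => /andP[c0 ct] st; exists c => //.
by rewrite !ger0_norm.
Qed.

Lemma sin_le_abs t : `|sin t| <= `|t|.
Proof.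
have [c _ ->] := sin_mean_value t.
by rewrite normrM ler_piMl// cos_max.
Qed.

Lemma one_sub_cos t : 1 - cos t = 2 * sin (t / 2) ^+ 2.
Proof.
have -> : cos t = cos ((t / 2) *+ 2) by congr cos; rewrite mulr2n; lra.
by rewrite cos_mulr2n cos2sin2 mulr2n; lra.
Qed.

Lemma cos_near1 t : `|cos t - 1| <= t ^+ 2.
Proof.
rewrite distrC one_sub_cos ger0_norm; last by have := sqr_ge0 (sin (t / 2)); lra.
have : sin (t / 2) ^+ 2 <= (t / 2) ^+ 2.
  rewrite -(real_normK (num_real (sin _))) -(real_normK (num_real (t / 2))).
  by rewrite lerXn2r ?nnegrE ?normr_ge0// sin_le_abs.
have := sqr_ge0 t; nra.
Qed.

Lemma sin_near t : `|t| <= 1 -> `|sin t - t| <= t ^+ 2.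
Proof.
move=> t1; have [c ct ->] := sin_mean_value t.
rewrite (_ : _ - _ = (cos c - 1) * t); last by ring.
rewrite normrM -(real_normK (num_real t)) expr2 ler_wpM2r//.
apply: (le_trans (cos_near1 c)).
rewrite -(real_normK (num_real c)) expr2.
by have := normr_ge0 c; have := normr_ge0 t; nra.
Qed.

Lemma expR_near x : `|x| <= 2^-1 -> `|expR x - 1 - x| <= 2 * x ^+ 2.
Proof.
rewrite ler_norml => /andP[x1 x2].
have h1 := expR_ge1Dx x; have h2 := expR_ge1Dx (- x).
have h3 := expRxMexpNx_1 x; have h4 := expR_gt0 x.
rewrite ger0_norm; last by lra.
have h5 : expR x * (1 - x) <= 1 by rewrite -[leRHS]h3 ler_pM2l.
have h6 : expR x <= 2 by nra.
have : expR x - 1 - x <= x * (expR x - 1) by lra.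
have [x0|x0] := leP 0 x.
  by nra.
have : 1 - expR x <= - x by lra.
by nra.
Qed.

End RealBounds.

Section ComplexExponential.
Variable R : realType.
Local Open Scope complex_scope.
Implicit Types (z u : R[i]) (x y s : R).

(** The point of the unit circle of argument [x]. *)
Definition cis x : R[i] := cos x +i* sin x.

(** The exponential of a complex number. *)
Definition cexp z : R[i] := (expR (Re z))%:C * cis (Im z).

Lemma cisD x y : cis (x + y) = cis x * cis y.
Proof.
apply/eqP; rewrite eq_complex ReM ImM /= cosD sinD.
by rewrite eqxx/= addrC [sin x * _]mulrC [cos y * _]mulrC addrC eqxx.
Qed.

Lemma cis0 : cis 0 = 1.
Proof. by rewrite /cis cos0 sin0. Qed.

Lemma cispi : cis pi = -1.
Proof. by rewrite /cis cospi sinpi; apply/eqP; rewrite eq_complex /= oppr0 !eqxx. Qed.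

Lemma cis_half_period x : x != 0 -> cis (x * `|pi / x|) = -1.
Proof.
move=> x0; have [h|h] := leP 0 (pi / x).
  by rewrite ger0_norm// mulrC divfK// cispi.
rewrite ltr0_norm// mulrN mulrC divfK//.
by rewrite -[RHS]cispi /cis cosN sinN sinpi oppr0.
Qed.

Lemma cmod_cis x : cmod (cis x) = 1.
Proof. by rewrite /cmod /= cos2Dsin2 sqrtr1. Qed.

Lemma cmod_cisB x y : cmod (cis x - cis y) <= `|x - y|.
Proof.
apply: ler_sqr_cmod => //; rewrite !ReImE /= real_normK ?num_real//.
rewrite (_ : _ + _ = (cos x ^+ 2 + sin x ^+ 2) + (cos y ^+ 2 + sin y ^+ 2)
  - 2 * (cos x * cos y + sin x * sin y)); last by ring.
rewrite !cos2Dsin2 -cosB.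
have h := one_sub_cos (x - y); have := sin_le_abs ((x - y) / 2).
rewrite -(@ler_pXn2r _ 2)// ?nnegrE// !real_normK ?num_real//.
by move: (x - y) h => t h; lra.
Qed.

Lemma cexpD z u : cexp (z + u) = cexp z * cexp u.
Proof. by rewrite /cexp !ReImE expRD rmorphM cisD/= mulrACA. Qed.

Lemma cexp0 : cexp 0 = 1.
Proof. by rewrite /cexp/= expR0 cis0 mulr1. Qed.

Lemma cexp_sum (I : Type) (r : seq I) (f : I -> R[i]) :
  cexp (\sum_(i <- r) f i) = \prod_(i <- r) cexp (f i).
Proof. exact: (big_morph _ cexpD cexp0). Qed.

Lemma cexpX z n : cexp z ^+ n = cexp (z *+ n).
Proof. by elim: n => [|n IH]; rewrite ?expr0 ?cexp0// exprS IH mulrS cexpD. Qed.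

Lemma cmod_cexp z : cmod (cexp z) = expR (Re z).
Proof. by rewrite cmodM cmod_cis mulr1 cmod_real ger0_norm ?expR_ge0. Qed.

Lemma cexp_near0 u : cmod u <= 2^-1 -> cmod (cexp u - 1 - u) <= 8 * cmod u ^+ 2.
Proof.
move=> hu; have hx := le_trans (cmod_ge_Re u) hu.
have hy := le_trans (cmod_ge_Im u) hu.
have hE := expR_near hx; have hC := cos_near1 (Im u).
have hS : `|sin (Im u) - Im u| <= Im u ^+ 2 by apply: sin_near; lra.
have hs := sin_le_abs (Im u).
apply: (le_trans (cmod_le_ReIm _)); rewrite cmod_sqr.
rewrite /cexp /cis !ReImE /= !mul0r subr0 addr0 oppr0 addr0.
move: (Re u) (Im u) hx hy hE hC hS hs => x y hx hy hE hC hS hs.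
have e2 : expR x <= 2.
  move: hE hx; rewrite !ler_norml => /andP[_ h] /andP[h1 h2]; nra.
have e0 := expR_ge0 x.
have ex : `|expR x - 1| <= 2 * `|x|.
  rewrite (_ : _ - 1 = (expR x - 1 - x) + x); last by ring.
  apply: (le_trans (ler_normD _ _)); move: hE; rewrite -(real_normK (num_real x)).
  by have := normr_ge0 x; nra.
have -> : expR x * cos y - 1 - x = (expR x - 1 - x) + expR x * (cos y - 1) by ring.
have -> : expR x * sin y - y = (expR x - 1) * sin y + (sin y - y) by ring.
apply: (@le_trans _ _ ((2 * x ^+ 2 + 2 * y ^+ 2) + (2 * (`|x| * `|y|) + y ^+ 2))).
  apply: lerD; apply: (le_trans (ler_normD _ _)); apply: lerD => //.
    by rewrite normrM ger0_norm// ler_pM.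
  by rewrite normrM mulrA ler_pM.
rewrite -(real_normK (num_real x)) -(real_normK (num_real y)).
by have := sqr_ge0 (`|x| - `|y|); nra.
Qed.

Lemma cexp_cdiff z : cdiff cexp z (cexp z).
Proof.
apply: (@cdiff_quad _ _ _ _ 2^-1 (cmod (cexp z) * 8)) => // u hu.
rewrite cexpD (_ : _ - _ = cexp z * (cexp u - 1 - u)); last by ring.
by rewrite cmodM -mulrA ler_wpM2l ?cmod_ge0// cexp_near0// ltW.
Qed.

Lemma cexp_imag s z :
  cexp ((0 +i* s) * z) = (expR (- (s * Im z)))%:C * cis (s * Re z).
Proof. by rewrite /cexp !ReImE/= !mul0r sub0r add0r. Qed.

(** Moving to the real axis changes [exp (i s z)] little. *)
Lemma cexp_imag_near s z : `|s * Im z| <= 2^-1 ->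
  cmod (cexp ((0 +i* s) * z) - cis (s * Re z)) <= 2 * `|s * Im z|.
Proof.
move=> h; rewrite cexp_imag -[X in _ - X]mul1r -mulrBl cmodM cmod_cis mulr1.
rewrite (_ : _ - 1 = (expR (- (s * Im z)) - 1)%:C); last by rewrite rmorphB rmorph1.
rewrite cmod_real; rewrite -normrN in h *; have hE := expR_near h.
move: (- _) h hE => x h hE.
rewrite (_ : _ - 1 = (expR x - 1 - x) + x); last by ring.
apply: (le_trans (ler_normD _ _)); move: hE; rewrite -(real_normK (num_real x)).
by have := normr_ge0 x; nra.
Qed.

End ComplexExponential.

(** * Trigonometric polynomials with a limit at infinity *)

Section TrigPoly.
Variable R : realType.
Local Open Scope complex_scope.

(** [f] tends to [l] at [+oo]. *)
Definition tends_at_infinity (f : R -> R[i]) (l : R[i]) := forall e : R, 0 < e ->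
  exists X : R, forall x, X <= x -> cmod (f x - l) <= e.

Lemma tends_at_infinity_shift f l (c : R[i]) (tau : R) : 0 <= tau ->
  tends_at_infinity f l ->
  tends_at_infinity (fun x => f (x + tau) - c * f x) (l - c * l).
Proof.
move=> t0 fl e e0; have c1 : 0 < 1 + cmod c by rewrite ltr_wpDr ?cmod_ge0.
have [X hX] := fl _ (divr_gt0 e0 c1); exists X => x Xx.
rewrite (_ : _ - _ = (f (x + tau) - l) - c * (f x - l)); last by ring.
apply: (le_trans (ler_cmodD _ _)); rewrite cmodN cmodM.
have := hX _ Xx; have : X <= x + tau by rewrite (le_trans Xx)// lerDl.
move=> /hX; rewrite !ler_pdivlMr//.
by have := cmod_ge0 c; nra.
Qed.

Lemma tends_at_infinity_ext f g l : f =1 g ->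
  tends_at_infinity f l -> tends_at_infinity g l.
Proof. by move=> /funext ->. Qed.

(** The translate of the sum by [tau], minus [cis (s j * tau)] times the sum,
    does not involve the frequency [s j], which allows for an induction on the
    number of frequencies. *)
Lemma trig_poly_limit (T : eqType) (S : seq T) (a : T -> R[i]) (s : T -> R) l :
  uniq S -> {in S &, injective s} ->
  tends_at_infinity (fun x => \sum_(i <- S) a i * cis (s i * x)) l ->
  forall k, k \in S -> s k != 0 -> a k = 0.
Proof.
have [n] := ubnP (size S); elim: n S a l => // n IH S a l; rewrite ltnS.
move=> Sn uS sS fl k kS sk.
case E : (rem k S) => [|j S'].
  pose tau := `|pi / s k|.
  have cE : cis (s k * tau) = -1 by exact: cis_half_period.
  apply/eqP; rewrite -cmod_eq0 eq_le cmod_ge0 andbT.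
  apply/ler_addgt0Pl => e e0; rewrite addr0.
  have [X hX] := fl _ e0.
  have h1 := hX X (lexx _).
  have h2 : X <= X + tau by rewrite lerDl normr_ge0.
  move/hX : h2; move: h1; rewrite !(big_rem k kS)/= E !big_nil !addr0.
  rewrite mulrDr cisD cE mulrN1 => h1 h2.
  have -> : cmod (a k) = cmod (a k * cis (s k * X)) by rewrite cmodM cmod_cis mulr1.
  rewrite mulrN in h2; move: (a k * _) h1 h2 => z h1 h2.
  have : cmod (2%:R * z) <= e + e.
    rewrite (_ : 2%:R * z = (z - l) - (- z - l)); last by ring.
    by apply: (le_trans (ler_cmodD _ _)); rewrite cmodN lerD.
  rewrite cmodM (_ : (2%:R : R[i]) = (2%:R : R)%:C); last by rewrite rmorph_nat.
  by rewrite cmod_real ger0_norm//; lra.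
have jrem : j \in rem k S by rewrite E mem_head.
have jS : j \in S by apply: mem_rem jrem.
have jk : j != k by move: jrem; rewrite mem_rem_uniq// inE => /andP[].
have skj : s k - s j != 0.
  by rewrite subr_eq0; apply: contra jk => /eqP/esym/sS -> //.
pose tau := `|pi / (s k - s j)|.
have ctau : cis (s k * tau) = - cis (s j * tau).
  rewrite (_ : s k * tau = s j * tau + (s k - s j) * tau); last by ring.
  by rewrite cisD cis_half_period// mulrN1.
pose a' i := a i * (cis (s i * tau) - cis (s j * tau)).
have fl' := tends_at_infinity_shift (cis (s j * tau)) (normr_ge0 _ : 0 <= tau) fl.
have kS' : k \in rem j S by rewrite mem_rem_uniq// inE eq_sym jk.
have sub : {subset rem j S <= S} by exact: mem_rem.
have := IH (rem j S) a' _ _ (rem_uniq j uS) (sub_in2 sub sS) _ k kS' sk.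
rewrite size_rem// => h.
have : a' k = 0.
  apply: (h (l - cis (s j * tau) * l)).
    by rewrite -ltnS prednK//; case: (S) jS.
  apply: tends_at_infinity_ext fl' => x.
  rewrite mulr_sumr -sumrB (big_rem j jS)/=.
  rewrite mulrDr cisD (_ : _ - _ = 0) ?add0r; last by ring.
  by apply: eq_bigr => i _; rewrite /a' mulrDr cisD; ring.
rewrite /a' ctau => /eqP; rewrite mulf_eq0 => /orP[/eqP//|].
rewrite -opprD oppr_eq0 -mulr2n -mulr_natl mulf_eq0 pnatr_eq0/=.
by rewrite -cmod_eq0 cmod_cis oner_eq0.
Qed.

End TrigPoly.

(** * A family of rationally independent reals indexed by the reals *)

Section Independent.
Variable R : realType.
Implicit Types (x : R) (K N : nat).

(** Membership of [N] in the set [{pickle (n, floor (n x)) | n}], the trace of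
    the real number [x]. Traces are infinite, and those of distinct numbers have
    a finite intersection. *)
Definition in_trace x N : bool :=
  if unpickle N is Some (n, z) then z == Num.floor ((n%:R : R) * x) :> int
  else false.

Lemma in_trace_pickle x (n : nat) (z : int) :
  in_trace x (pickle (n, z)) = (z == Num.floor ((n%:R : R) * x)).
Proof. by rewrite /in_trace pickleK. Qed.

Definition gap N : R := 2^-1 ^+ (N ^ 2).

Definition trace_term x N : R := (in_trace x N)%:R * gap N.

(** The number whose binary digits of index [N ^ 2] are given by the trace of
    [x], the other ones being zero. *)
Definition trace_real x : R := limn (series (trace_term x)).

Lemma gap_gt0 N : 0 < gap N.
Proof. exact: exprn_gt0. Qed.

Lemma trace_term_ge0 x N : 0 <= trace_term x N.
Proof. by rewrite mulr_ge0// ltW// gap_gt0. Qed.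

Lemma trace_term_le x K j :
  trace_term x (K.+1 + j)%N <= gap K * 2^-1 ^+ K * 2^-1 ^+ j.+1.
Proof.
apply: (@le_trans _ _ (gap (K.+1 + j))).
  by rewrite ler_piMl ?(ltW (gap_gt0 _))// lern1 leq_b1.
rewrite /gap -!exprD ler_wiXn2l// ?invf_le1 ?ler1n//.
(* [(K + 1 + j) ^ 2 >= K ^ 2 + K + (j + 1)] *)
nia.
Qed.

Lemma trace_sum_le x K L :
  \sum_(N < L) trace_term x N <= \sum_(N < K.+1) trace_term x N + gap K * 2^-1 ^+ K.
Proof.
have c0 : 0 <= gap K * 2^-1 ^+ K by rewrite mulr_ge0 ?exprn_ge0.
have [LK|KL] := leqP L K.+1.
  rewrite -(subnKC LK) big_split_ord/= -addrA lerDl addr_ge0//.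
  by apply: sumr_ge0 => i _; exact: trace_term_ge0.
rewrite -(subnKC (ltnW KL)) big_split_ord/= lerD2l.
pose b j : R := gap K * 2^-1 ^+ K * 2^-1 ^+ j.
apply: (le_trans (@ler_sum_telescope _ (fun j => trace_term x (K.+1 + j)%N) b _ _)).
  move=> j; apply: (le_trans (trace_term_le x K j)); rewrite /b exprS.
  by rewrite -subr_ge0 (_ : _ - _ = 0)//; field.
by rewrite /b expr0 mulr1 lerBlDr lerDl mulr_ge0// exprn_ge0.
Qed.

Lemma trace_real_tail x K :
  0 <= trace_real x - \sum_(N < K.+1) trace_term x N <= gap K * 2^-1 ^+ K.
Proof.
have cx : cvgn (series (trace_term x)).
  apply: nondecreasing_is_cvgn.
    by apply: nondecreasing_series => n _ _; exact: trace_term_ge0.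
  exists (\sum_(N < 1) trace_term x N + gap 0 * 2^-1 ^+ 0) => _ [L _ <-].
  by rewrite seriesEord; exact: trace_sum_le.
apply/andP; split.
  rewrite subr_ge0; apply: limr_ge => //; near=> L.
  have KL : (K.+1 <= L)%N by near: L; exact: nbhs_infty_ge.
  rewrite seriesEord/= -(subnKC KL) big_split_ord/= lerDl.
  by apply: sumr_ge0 => i _; exact: trace_term_ge0.
rewrite lerBlDl; apply: limr_le => //; near=> L.
by rewrite seriesEord; exact: trace_sum_le.
Unshelve. all: by end_near. Qed.

Lemma gap_ratio_int K N : (N <= K)%N -> gap N / gap K \is a Num.int.
Proof.
move=> NK; rewrite /gap -!exprVn invrK.
have h : (N ^ 2 <= K ^ 2)%N by rewrite leq_sqr.
rewrite -(subnKC h) exprD mulrA -exprMn mulVf ?pnatr_eq0// expr1n mul1r.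
by rewrite rpredX// natr_int.
Qed.

Section Relation.
Variables (n : nat) (x : 'I_n -> R) (m : 'I_n -> int).
Hypothesis x_inj : injective x.
Hypothesis rel0 : \sum_i (m i)%:~R * trace_real (x i) = 0.

Let D K := \sum_i (m i)%:~R * \sum_(N < K.+1) trace_term (x i) N.

Let D_small K : `|D K| <= (\sum_i `|(m i)%:~R| : R) * (gap K * 2^-1 ^+ K).
Proof.
rewrite (_ : D K = - \sum_i (m i)%:~R *
    (trace_real (x i) - \sum_(N < K.+1) trace_term (x i) N)); last first.
  under eq_bigr do rewrite mulrBr.
  by rewrite sumrB rel0 sub0r opprK.
rewrite normrN (le_trans (ler_norm_sum _ _ _))// mulr_suml ler_sum// => i _.
rewrite normrM ler_wpM2l//; have /andP[h1 h2] := trace_real_tail (x i) K.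
by rewrite ger0_norm.
Qed.

Let D_int K : D K / gap K \is a Num.int.
Proof.
rewrite mulr_suml rpred_sum// => i _.
rewrite -mulrA rpredM ?intr_int// mulr_suml rpred_sum// => N _.
by rewrite -mulrA rpredM ?natr_int// gap_ratio_int// -ltnS.
Qed.

Let D_eventually0 : exists K0, forall K, (K0 <= K)%N -> D K = 0.
Proof.
pose M : R := \sum_i `|(m i)%:~R|.
have M0 : 0 <= M by apply: sumr_ge0.
have [K0 hK0] : exists K0, forall K, (K0 <= K)%N -> M * 2^-1 ^+ K < 1.
  exists (Num.truncn M).+1 => K hK.
  rewrite exprVn -[_ * _]/(M / _) ltr_pdivrMr ?exprn_gt0// mul1r.
  apply: (lt_le_trans (truncnS_gt M)).
  apply: (@le_trans _ _ K%:R); first by rewrite ler_nat.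
  by rewrite -natrX ler_nat ltnW// ltn_expl.
exists K0 => K hK; apply/eqP; apply: contraT => DK.
have : 1 <= `|D K / gap K|.
  by rewrite norm_intr_ge1 ?D_int// mulf_neq0// invr_neq0// gt_eqF// gap_gt0.
rewrite normrM normfV [`|gap K|]ger0_norm ?(ltW (gap_gt0 _))//.
rewrite ler_pdivlMr ?gap_gt0// mul1r => h.
have := le_trans h (D_small K).
rewrite -/M mulrCA -[leLHS]mulr1 ler_pM2l ?gap_gt0//.
by rewrite leNgt hK0.
Qed.

Let digit_relation : exists K0, forall K, (K0 <= K)%N ->
  \sum_i (m i)%:~R * (in_trace (x i) K)%:R = 0 :> R.
Proof.
have [K0 hK0] := D_eventually0; exists K0.+1 => -[//|K]; rewrite ltnS => hK.
have : D K.+1 - D K = 0 by rewrite !hK0 ?subrr// leqW.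
rewrite /D -sumrB.
under eq_bigr do rewrite -mulrBr big_ord_recr/= addrAC subrr add0r mulrA.
rewrite -mulr_suml => /eqP; rewrite mulf_eq0 => /orP[/eqP//|].
by rewrite gt_eqF// gap_gt0.
Qed.

Let floor_separated (j : 'I_n) : exists k0, forall k, (k0 <= k)%N ->
  forall i, i != j -> Num.floor (k%:R * x i) != Num.floor (k%:R * x j).
Proof.
have [B hB] : exists B, forall i, i != j -> `|x i - x j|^-1 <= B.
  exists (\sum_i `|x i - x j|^-1) => i _.
  by rewrite (bigD1 i)//= lerDl sumr_ge0.
exists (Num.truncn B).+1 => k hk i ij; apply/eqP => E.
have xij : 0 < `|x i - x j|.
  by rewrite normr_gt0 subr_eq0; apply: contra ij => /eqP/x_inj ->.
have /andP[a1 a2] := floor_itv (k%:R * x i).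
have /andP[b1 b2] := floor_itv (k%:R * x j).
rewrite E in a1 a2; rewrite intrD in a2 b2.
have : `|k%:R * x i - k%:R * x j| < 1 by rewrite ltr_norml; apply/andP; split; lra.
rewrite -mulrBr normrM ger0_norm// ltNge => /negP; apply.
rewrite -ler_pdivrMr// mul1r (le_trans (hB _ ij))// ltW//.
by apply: (lt_le_trans (truncnS_gt B)); rewrite ler_nat.
Qed.

(** For large [K], multiplying the relation by [2 ^ (K ^ 2)] splits it into an
    integer, given by the digits of index at most [K ^ 2], and a remainder of
    modulus less than [1]: both vanish, and subtracting the equations for
    consecutive values of [K] leaves a relation between single digits. For [K]
    in the trace of [x j] only, it reads [m j = 0]. *)
Lemma trace_real_relation j : m j = 0.
Proof.
have [K0 hK0] := digit_relation; have [k0 hk0] := floor_separated j.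
pose code k := pickle (k, Num.floor ((k%:R : R) * x j)).
have [k k0k Kk] : exists2 k, (k0 <= k)%N & (K0 <= code k)%N.
  apply: contrapT => h.
  have hlt k : (k0 <= k)%N -> (code k < K0)%N.
    by move=> kk; rewrite ltnNge; apply/negP => kk'; apply: h; exists k.
  have code_inj : injective code by move=> a b /(pcan_inj pickleK)[].
  have : uniq (map code (iota k0 K0.+1)) by rewrite map_inj_uniq// iota_uniq.
  move/uniq_leq_size => /(_ (iota 0 K0)).
  rewrite size_map !size_iota ltnn => /(_ _)/negP; apply; last by [].
  move=> _ /mapP[k + ->]; rewrite !mem_iota add0n => /andP[kk _].
  by rewrite /= hlt.
have := hK0 _ Kk; rewrite (bigD1 j)//= /code in_trace_pickle eqxx mulr1.
rewrite big1 ?addr0; first by move/eqP; rewrite intr_eq0 => /eqP.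
by move=> i ij; rewrite in_trace_pickle eq_sym (negbTE (hk0 _ k0k _ ij)) mulr0.
Qed.

End Relation.

End Independent.

(** * Null sets of the circle *)

Section NullSet.
Variable R : realType.
Local Open Scope complex_scope.

Lemma negligible_cover (T : set R) (e : R) :
  (@lebesgue_measure R).-negligible T -> 0 < e ->
  exists a : nat -> R, exists d : nat -> R,
    [/\ forall k, 0 < d k, forall K, \sum_(k < K) d k <= e &
        forall t, T t -> exists k, `|t - a k| <= d k].
Proof.
move=> /negligible_outer_measure T0 e0; have e20 : 0 < e / 2 by rewrite divr_gt0.
have [F [FI TF] Fe] : exists2 F, open_itv_cover T F &
    (\sum_(0 <= k <oo) wlength idfun (F k) <= (e / 2)%:E)%E.
  have : ((wlength idfun)^* T)%mu \is a fin_num by rewrite T0.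
  rewrite measurable_realfun.outer_measure_open_itv_cover.
  move=> /lb_ereal_inf_adherent-/(_ _ e20)[_/= [F]] TF <- Fe; exists F => //.
  apply/ltW; apply: (lt_le_trans Fe).
  by rewrite -measurable_realfun.outer_measure_open_itv_cover T0 add0e.
have /choice[ab hab] : forall k, exists p : R * R, F k = `]p.1, p.2[%classic.
  by move=> k; have [p ->] := FI k; exists p.
(* The intervals may be empty; a geometric term makes all lengths positive. *)
pose len k : R := Num.max ((ab k).2 - (ab k).1) 0.
have lenE k : wlength idfun (F k) = (len k)%:E.
  rewrite hab wlength_itv/= lte_fin /len.
  have [h|h] := ltP (ab k).1 (ab k).2.
    by rewrite max_l ?EFinB// subr_ge0 ltW.
  by rewrite max_r// subr_le0.
have len0 k : 0 <= len k by rewrite /len le_max lexx orbT.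
exists (fun k => (ab k).1), (fun k => len k + e / 2 * 2^-1 ^+ k.+1); split.
- by move=> k; rewrite ltr_wpDl// mulr_gt0// exprn_gt0.
- move=> K; rewrite big_split/= [leRHS](splitr e) lerD//.
    rewrite -lee_fin; apply: le_trans Fe; rewrite -sumEFin.
    under eq_bigr do rewrite -lenE.
    rewrite -(big_mkord xpredT (fun k => wlength idfun (F k))).
    by apply: nneseries_lim_ge => k _ _; rewrite lenE lee_fin.
  pose b k : R := e / 2 * 2^-1 ^+ k.
  apply: (le_trans (@ler_sum_telescope _ (fun k => e / 2 * 2^-1 ^+ k.+1) b _ _)).
    by move=> k; rewrite /b exprS; lra.
  by rewrite /b expr0 mulr1 lerBlDr lerDl mulr_ge0 ?exprn_ge0// ltW.
- move=> t /TF[k _]; rewrite hab/= in_itv/= => /andP[h1 h2]; exists k.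
  rewrite ger0_norm ?subr_ge0 ?ltW//.
  have : (ab k).2 - (ab k).1 <= len k by rewrite le_max lexx.
  have : 0 < e / 2 * 2^-1 ^+ k.+1 by rewrite mulr_gt0// exprn_gt0.
  by lra.
Qed.

Lemma unit_circle_cis (w : R[i]) : cmod w = 1 ->
  exists2 t : R, 0 <= t < 2 * pi & w = cis t.
Proof.
move=> w1; have := cmod_sqr w; rewrite w1 expr1n.
case: w w1 => x y /= _ xy.
have x1 : -1 <= x <= 1.
  by have y2 := sqr_ge0 y; apply/andP; split; nra.
have sE : sin (acos x) = `|y|.
  by rewrite sin_acos// xy addrC addKr sqrtr_sqr.
have cE : cos (acos x) = x by rewrite acosK// in_itv.
have p0 := acos_ge0 x1; have p1 := acos_lepi x1; have ppi := @pi_gt0 R.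
have [y0|y0] := leP 0 y.
  exists (acos x); first by rewrite p0/=; lra.
  by rewrite /cis cE sE ger0_norm.
have ac0 : 0 < acos x.
  apply: acos_gt0; case/andP: x1 => -> x1 /=.
  by rewrite lt_neqAle x1 andbT; apply/eqP => E; nra.
exists (pi *+ 2 - acos x).
  rewrite -mulr_natl; apply/andP; split; lra.
by rewrite /cis addrC cosD2pi sinD2pi cosN sinN cE sE ltr0_norm// opprK.
Qed.

(** Each row consists of arcs covering [E] and the point [1]; [alpha n k] is the
    conjugate of the centre of an arc. *)
Lemma circle_null_rows (E : set R[i]) :
  circle_null E -> exists alpha : nat -> nat -> R[i], exists d : nat -> nat -> R,
    [/\ forall n k, cmod (alpha n k) <= 1, forall n k, 0 < d n k,
        forall n K, \sum_(k < K) d n k <= 2^-1 ^+ n &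
        forall w, cmod w = 1 -> E w \/ w = 1 ->
          forall n, exists k, cmod (1 - alpha n k * w) <= d n k].
Proof.
(* The argument [0] accounts for the point [1], which need not be in [E]. *)
move=> E0; pose T := (`[0, 2 * pi[ `&` [set t : R | E (cos t +i* sin t)]) `|` [set 0].
have T0 : (@lebesgue_measure R).-negligible T.
  apply: negligibleU => //; apply/negligibleP; first exact: measurable_set1.
  exact: lebesgue_measure_set1.
have h n : exists ad : (nat -> R) * (nat -> R),
    [/\ forall k, 0 < ad.2 k, forall K, \sum_(k < K) ad.2 k <= 2^-1 ^+ n &
        forall t, T t -> exists k, `|t - ad.1 k| <= ad.2 k].
  have [|a [d ?]] := negligible_cover (e := 2^-1 ^+ n) T0; first exact: exprn_gt0.
  by exists (a, d).
have [ad had] := choice h.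
exists (fun n k => cis (- (ad n).1 k)), (fun n k => (ad n).2 k); split.
- by move=> n k; rewrite cmod_cis.
- by move=> n k; have [] := had n.
- by move=> n K; have [_ + _] := had n; exact.
move=> w w1 Ew n.
have [t Tt ->] : exists2 t, T t & w = cis t.
  case: Ew => [Ew| ->]; last by exists 0; [right|rewrite cis0].
  have [t t2 wt] := unit_circle_cis w1; exists t => //; left; split.
    by rewrite /= in_itv.
  by rewrite /= -/(cis t) -wt.
have [_ _ /(_ t Tt)[k hk]] := had n; exists k.
rewrite -cisD -cis0 (le_trans (cmod_cisB _ _))//.
by rewrite sub0r normrN addrC.
Qed.

End NullSet.

(** * Exponentials of the phase *)

Lemma continuous_of_modulus (R : realType) (f : R -> R) (r : R) :
  (forall e, 0 < e -> exists2 d, 0 < d &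
    forall h, `|h| < d -> `|f (r + h) - f r| <= e) ->
  {for r, continuous f}.
Proof.
move=> hf; apply/cvgrPdist_le => e e0; have [d d0 hd] := hf e e0.
near=> r'.
have rr : `|r - r'| < d by near: r'; exact: cvgr_dist_lt.
have := hd (r' - r); rewrite subrKC distrC => /(_ rr).
by rewrite distrC.
Unshelve. all: by end_near. Qed.

Section AlongPath.
Variable R : realType.
Local Open Scope complex_scope.

(** [P r] holds for [r < 1] close enough to [1]. *)
Definition near_one (P : R -> Prop) :=
  exists2 r0 : R, 0 <= r0 < 1 & forall r, r0 <= r < 1 -> P r.

Lemma near_one_and (P Q : R -> Prop) :
  near_one P -> near_one Q -> near_one (fun r => P r /\ Q r).
Proof.
move=> [p /andP[p0 p1] hp] [q /andP[q0 q1] hq].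
exists (Num.max p q); first by rewrite le_max p0 gt_max p1.
move=> r; rewrite ge_max => /andP[/andP[pr qr] r1].
by split; [apply: hp|apply: hq]; apply/andP.
Qed.

(** If [p r] is asymptotically real and its real part takes all large values as
    [r] tends to [1], then an exponential sum along [p] has a limit only if the
    trigonometric polynomial with the same coefficients and frequencies has one
    at infinity. *)
Lemma exp_sum_radial (p : R -> R[i]) (T : eqType) (S : seq T)
    (a : T -> R[i]) (s : T -> R) l :
  (forall M : R, near_one (fun r => M <= Re (p r))) ->
  (forall e : R, 0 < e -> near_one (fun r => `|Im (p r)| <= e)) ->
  (forall b0 b1 : R, 0 <= b0 -> b1 < 1 ->
    {within `[b0, b1], continuous (fun r => Re (p r))}) ->
  (forall e : R, 0 < e -> near_one (fun r =>
    cmod (\sum_(k <- S) a k * cexp ((0 +i* s k) * p r) - l) <= e)) ->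
  tends_at_infinity (fun x => \sum_(k <- S) a k * cis (s k * x)) l.
Proof.
move=> pRe pIm pc hl e e0; have e20 : 0 < e / 2 by rewrite divr_gt0.
pose A : R := \sum_(k <- S) cmod (a k) * (2 * `|s k|).
have A0 : 0 <= A by apply: sumr_ge0 => k _; rewrite !mulr_ge0 ?cmod_ge0.
(* [eta] bounds the imaginary part of [p r]; the exponential sum is then within
   [e / 2] of its value with [p r] replaced by its real part. *)
have [eta eta0 [etaA etaB]] : exists2 eta : R, 0 < eta &
    A * eta <= e / 2 /\ \sum_(k <- S) `|s k| * eta <= 2^-1.
  pose C : R := \sum_(k <- S) `|s k|.
  have C0 : 0 <= C by apply: sumr_ge0.
  have AC : 0 < A + C + 1 by lra.
  exists (Num.min (e / 2) (2^-1) / (A + C + 1)).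
    by rewrite divr_gt0// lt_min e20 invr_gt0 ltr0n.
  rewrite -mulr_suml -/C.
  have m0 : 0 < Num.min (e / 2) (2^-1) by rewrite lt_min e20 invr_gt0 ltr0n.
  have m1 : Num.min (e / 2) (2^-1) <= e / 2 by rewrite ge_min lexx.
  have m2 : Num.min (e / 2) (2^-1) <= 2^-1 by rewrite ge_min lexx orbT.
  move: (Num.min _ _) m0 m1 m2 => m m0 m1 m2.
  by split; rewrite mulrA ler_pdivrMr//; nra.
have [r1 /andP[r10 r11] hr1] := near_one_and (hl _ e20) (pIm _ eta0).
exists (Re (p r1)) => x hx.
have [r2 /andP[r20 r21] hr2] := pRe x.
pose r3 := Num.max r1 r2.
have r31 : r3 < 1 by rewrite gt_max r11.
have r13 : r1 <= r3 by rewrite le_max lexx.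
have hr3 : x <= Re (p r3).
  by apply: hr2; rewrite r31 andbT le_max lexx orbT.
have [|r] := @IVT _ _ _ _ x r13 (pc _ _ r10 r31).
  by rewrite ge_min hx le_max hr3 orbT.
rewrite in_itv/= => /andP[r1r rr3] rx.
have rr : r1 <= r < 1 by rewrite r1r (le_lt_trans rr3).
have [h1 h2] := hr1 _ rr.
rewrite -rx; set z := p _ in rx h2 *.
rewrite -(subrK (\sum_(k <- S) a k * cexp ((0 +i* s k) * p r)) (\sum_(k <- S) _)).
rewrite -addrA [leRHS](splitr e) (le_trans (ler_cmodD _ _))// lerD//.
rewrite cmodB -sumrB; apply: le_trans etaA; rewrite /A mulr_suml.
apply: (le_trans (cmod_sum _ _)).
rewrite [leLHS]big_seq [leRHS]big_seq ler_sum// => k kS.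
rewrite -mulrBr cmodM -mulrA ler_wpM2l ?cmod_ge0//.
have hk : `|s k * Im z| <= `|s k| * eta by rewrite normrM ler_wpM2l.
have hs : `|s k| * eta <= 2^-1.
  apply: le_trans etaB; rewrite (big_rem k kS)/= lerDl sumr_ge0// => i _.
  by rewrite mulr_ge0// ltW.
apply: (le_trans (cexp_imag_near (le_trans hk hs))).
by rewrite -mulrA ler_pM2l.
Qed.

End AlongPath.

Section Phase.
Variable R : realType.
Local Open Scope complex_scope.
Variables (alpha : nat -> nat -> R[i]) (d : nat -> nat -> R).
Hypothesis alpha1 : forall n k, cmod (alpha n k) <= 1.
Hypothesis d0 : forall n k, 0 < d n k.
Hypothesis dsum : forall n K, \sum_(k < K) d n k <= 2^-1 ^+ n.
Implicit Types (z w : R[i]) (r c : R).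

(** The second application of [dig] makes the imaginary part tend to zero
    wherever the real part tends to infinity. *)
Definition phase z : R[i] := dig (dig (pole_sum alpha d z)).

Let pole_ge0 z : cmod z < 1 -> 0 <= Re (pole_sum alpha d z).
Proof. exact: pole_sum_Re_ge0. Qed.

Lemma phase_cdiff z : cmod z < 1 -> exists l, cdiff phase z l.
Proof.
move=> z1; have h0 := pole_ge0 z1; have h1 := dig_Re_ge0 h0.
have hp := cdiff_comp (pole_sum_cdiff alpha1 d0 dsum z1) (dig_cdiff h0).
by have h := cdiff_comp hp (dig_cdiff h1); eexists; exact: h.
Qed.

Lemma phase_Im z : cmod z < 1 -> `|Im (phase z)| <= 2.
Proof. by move=> z1; apply/dig_Im_le2/dig_Re_ge0/pole_ge0. Qed.

(** The function [exp (i c Z)], for [Z] the phase. *)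
Definition phase_exp c z : R[i] := cexp ((0 +i* c) * phase z).

Lemma phase_exp_cdiff c z : cmod z < 1 -> exists l, cdiff (phase_exp c) z l.
Proof.
move=> /phase_cdiff[l hl].
have h := cdiff_comp (cdiff_comp hl (cdiff_scale (0 +i* c) _)) (@cexp_cdiff R _).
by eexists; exact: h.
Qed.

Lemma phase_exp_bounded c z : cmod z < 1 ->
  cmod (phase_exp c z) <= expR (`|c| * 2).
Proof.
move=> z1; rewrite cmod_cexp ReM/= mul0r sub0r ler_expR.
apply: (le_trans (ler_norm _)); rewrite normrN normrM ler_wpM2l//.
exact: phase_Im.
Qed.

Section Radius.
Variable w : R[i].
Hypothesis w1 : cmod w = 1.
Hypothesis wcover : forall n, exists k, cmod (1 - alpha n k * w) <= d n k.

Lemma cmod_radius r : 0 <= r < 1 -> cmod (r%:C * w) < 1.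
Proof. by move=> /andP[r0 r1]; rewrite cmodM w1 mulr1 cmod_real ger0_norm. Qed.

Lemma dig_pole_radial (M : R) :
  near_one (fun r => M <= Re (dig (pole_sum alpha d (r%:C * w)))).
Proof.
have [A _ hA] := dig_Re_unbounded M.
have [r0 r01 hr] := pole_sum_radial alpha1 d0 dsum w1 wcover A.
by exists r0 => // r /hr; exact: hA.
Qed.

Lemma phase_Re_radial (M : R) : near_one (fun r => M <= Re (phase (r%:C * w))).
Proof.
have [A _ hA] := dig_Re_unbounded M.
by have [r0 r01 hr] := dig_pole_radial A; exists r0 => // r /hr; exact: hA.
Qed.

Lemma phase_Im_radial (e : R) : 0 < e ->
  near_one (fun r => `|Im (phase (r%:C * w))| <= e).
Proof.
move=> e0; have [r0 /andP[r00 r01] hr] := dig_pole_radial (2 / e).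
exists r0 => [|r rr]; first exact/andP.
have r1 : cmod (r%:C * w) < 1.
  by case/andP: rr => h h'; apply: cmod_radius; rewrite h' (le_trans r00).
have h := hr _ rr; have e2 : 0 < 2 / e by rewrite divr_gt0.
have p0 := lt_le_trans e2 h.
apply: (le_trans (dig_Im_small p0)).
rewrite ler_pdivrMr// (le_trans (dig_Im_le2 (pole_ge0 r1)))//.
by rewrite mulrC -ler_pdivrMr.
Qed.

Lemma phase_Re_continuous (a b : R) : 0 <= a -> b < 1 ->
  {within `[a, b], continuous (fun r => Re (phase (r%:C * w)))}.
Proof.
move=> a0 b1; apply: continuous_in_subspaceT => r; rewrite inE => /itvP rab.
have r1 : cmod (r%:C * w) < 1.
  by apply: cmod_radius; rewrite (le_trans a0) ?rab//= (le_lt_trans _ b1) ?rab.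
have [l hl] := phase_cdiff r1.
apply: continuous_of_modulus => e e0; have [dl dl0 hd] := cdiff_cont hl e0.
exists dl => // h hdl; rewrite -ReN -ReD (le_trans (cmod_ge_Re _))//.
have := hd (h%:C * w); rewrite cmodM w1 mulr1 cmod_real => /(_ hdl).
by rewrite rmorphD/= mulrDl.
Qed.

End Radius.
End Phase.

(** * The algebra generated by the exponentials of the phase *)

Section Frequencies.
Variable R : realType.

(** The frequency of the monomial of exponent [m] in exponentials of frequencies
    [c]. *)
Definition freq (N : nat) (c : 'I_N -> R) (m : multinom N) : R :=
  \sum_i (m i)%:R * c i.

Lemma freq_inj (N : nat) (x : 'I_N -> R) :
  injective x -> injective (freq (fun i => trace_real (x i))).
Proof.
move=> x_inj m m' E; apply/mnmP => i.
have : \sum_i (((m i)%:Z - (m' i)%:Z)%:~R : R) * trace_real (x i) = 0.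
  under eq_bigr do rewrite intrB mulrBl.
  by rewrite sumrB; apply/eqP; rewrite subr_eq0; apply/eqP.
by move=> /(trace_real_relation x_inj) /(_ i) /eqP; rewrite subr_eq0 => /eqP[].
Qed.

Lemma trace_real_gt0 (x : R) : 0 < trace_real x.
Proof.
rewrite lt_neqAle; apply/andP; split; last first.
  have /andP[+ _] := trace_real_tail x 0.
  rewrite subr_ge0; apply: le_trans; apply: sumr_ge0 => i _.
  exact: trace_term_ge0.
apply/eqP => x0.
have inj : injective (fun _ : 'I_1 => x) by move=> i j _; rewrite !ord1.
have := @trace_real_relation R 1 _ (fun=> 1) inj _ ord0.
by rewrite big_ord1 -x0 mulr0 => /(_ erefl).
Qed.

Lemma trace_real_inj : injective (@trace_real R).
Proof.
move=> x y xy; apply/eqP; apply: contraT => nxy.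
pose p (i : 'I_2) := if i == ord0 then x else y.
pose m (i : 'I_2) : int := if i == ord0 then 1 else -1.
have p_inj : injective p.
  move=> i j; rewrite /p.
  case: (i =P ord0) => [->|/eqP i0]; case: (j =P ord0) => [->|/eqP j0] // E.
  - by rewrite E eqxx in nxy.
  - by rewrite E eqxx in nxy.
  - by apply/val_inj; case: i j i0 j0 {E} => [[|[|?]] ?] [[|[|?]] ?].
have := @trace_real_relation R 2 p m p_inj _ ord0.
by rewrite !big_ord_recl big_ord0 /p /m /= xy mulN1r mul1r addr0 subrr => /(_ erefl).
Qed.

Lemma freq_neq0 (N : nat) (x : 'I_N -> R) (m : multinom N) : m != mnm0 ->
  freq (fun i => trace_real (x i)) m != 0.
Proof.
apply: contra => /eqP m0; apply/eqP/mnmP => i; rewrite mnmE.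
have p j : 0 <= (m j)%:R * trace_real (x j).
  by rewrite mulr_ge0// ltW// trace_real_gt0.
have /eqP := psumr_eq0P (fun j _ => p j) m0 (i := i) isT.
by rewrite mulf_eq0 [trace_real _ == 0]gt_eqF ?trace_real_gt0// orbF pnatr_eq0 => /eqP.
Qed.

End Frequencies.

Section Generators.
Variable R : realType.
Local Open Scope complex_scope.
Variables (alpha : nat -> nat -> R[i]) (d : nat -> nat -> R).
Hypothesis alpha1 : forall n k, cmod (alpha n k) <= 1.
Hypothesis d0 : forall n k, 0 < d n k.
Hypothesis dsum : forall n K, \sum_(k < K) d n k <= 2^-1 ^+ n.

Let ph : R[i] -> R[i] := phase alpha d.

Lemma disc_cmod (z : disc R) : cmod (sval z) < 1.
Proof. by case: z => z /= z1; rewrite -ltcR -normrE. Qed.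

Lemma cmod_disc (z : R[i]) : cmod z < 1 -> `|z| < 1.
Proof. by rewrite normrE -[X in _ -> _ < X]/(1%:C) ltcR. Qed.

Definition gen_fun (c : R) (z : disc R) : R[i] := phase_exp alpha d c (sval z).

Lemma gen_fun_Hinf c : gen_fun c \in @Hinf_pred R.
Proof.
rewrite inE; split.
  move=> z z1; have z1' : cmod z < 1 by rewrite -ltcR -normrE.
  have [l hl] := phase_exp_cdiff alpha1 d0 dsum c z1'.
  apply: (@cdiff_derivable _ _ _ l).
  have r0 : 0 < 1 - cmod z by rewrite subr_gt0.
  apply: cdiff_near r0 _ hl => u hu; apply: disc_ext_in.
  by apply: cmod_disc; have := ler_cmodD z u; lra.
exists (expR (`|c| * 2)) => z; rewrite normrE lecR.
exact/phase_exp_bounded/disc_cmod.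
Qed.

(** [phase_exp c] as an element of the algebra. *)
Definition gen c : Hinf R := exist _ (gen_fun c) (gen_fun_Hinf c).

Lemma Hinf_sum_at (I : Type) (r : seq I) (f : I -> Hinf R) (z : disc R) :
  sval (\sum_(i <- r) f i) z = \sum_(i <- r) sval (f i) z.
Proof. by elim/big_rec2 : _ => // i a b _ <-. Qed.

Lemma Hinf_prod_at (I : Type) (r : seq I) (f : I -> Hinf R) (z : disc R) :
  sval (\prod_(i <- r) f i) z = \prod_(i <- r) sval (f i) z.
Proof. by elim/big_rec2 : _ => // i a b _ <-. Qed.

Lemma Hinf_exp_at (f : Hinf R) n (z : disc R) : sval (f ^+ n) z = sval f z ^+ n.
Proof. by elim: n => // n IH; rewrite !exprS -IH. Qed.

(** A polynomial in the generators is an exponential sum in the phase. *)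
Lemma mpoly_eval_gen (N : nat) (c : 'I_N -> R) (Q : mpoly N R[i]) (z : disc R) :
  sval (mpoly_eval Q (fun i => gen (c i))) z =
  \sum_(m <- msupp Q) mcoeff m Q * cexp ((0 +i* freq c m) * ph (sval z)).
Proof.
rewrite /mpoly_eval /mmap Hinf_sum_at; apply: eq_bigr => m _.
rewrite -[LHS]/(mcoeff m Q * 1 * sval (mmap1 (fun i => gen (c i)) m) z).
rewrite mulr1; congr (_ * _).
rewrite /mmap1 Hinf_prod_at.
under eq_bigr do rewrite Hinf_exp_at /= /gen_fun /phase_exp cexpX.
rewrite -cexp_sum -/ph; congr cexp.
under eq_bigr do rewrite -mulrnAl.
rewrite -mulr_suml; congr (_ * _).
apply/eqP; rewrite eq_complex Re_sum Im_sum; apply/andP; split; apply/eqP => /=.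
  by apply: big1 => i _; elim: (m i) => // n; rewrite mulrS ReD /= add0r.
apply: eq_bigr => i _; rewrite mulr_natl.
by elim: (m i) => // n; rewrite !mulrS ImD => ->.
Qed.

Section RadialLimit.
Variables (w : R[i]) (T : eqType) (S : seq T) (a : T -> R[i]) (s : T -> R).
Hypothesis w1 : cmod w = 1.
Hypothesis wcover : forall n, exists k, cmod (1 - alpha n k * w) <= d n k.
Variable f : Hinf R.
Hypothesis fE : forall z, sval f z =
  \sum_(k <- S) a k * cexp ((0 +i* s k) * ph (sval z)).

Lemma radial_limit_trig_poly : has_radial_limit f w ->
  exists l, tends_at_infinity (fun x => \sum_(k <- S) a k * cis (s k * x)) l.
Proof.
move=> /cvg_ex[l /cvgrPdist_le hl]; exists l.
apply: (@exp_sum_radial _ (fun r => ph (r%:C * w))).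
- exact: phase_Re_radial.
- by move=> e; exact: phase_Im_radial.
- exact: phase_Re_continuous.
move=> e e0.
have ee : 0 < e%:C by rewrite ltcR.
have := hl _ ee; rewrite near_withinE => /nbhs_ballP[r0 /= r00 hr].
exists (Num.max 0 (1 - r0 / 2)); first by rewrite le_max lexx gt_max ltr01; lra.
move=> r; rewrite ge_max => /andP[/andP[r1 r2] r3].
have h : cmod (r%:C * w) < 1 by apply: cmod_radius => //; rewrite r1.
have := hr r; rewrite /ball/= => /(_ _ r3).
rewrite (disc_ext_in _ (cmod_disc h)) fE /= normrE lecR cmodB; apply.
by rewrite ger0_norm; lra.
Qed.

(** Grouping the terms of equal frequency. *)
Lemma radial_limit_eq0 : has_radial_limit f w ->
  (forall k, k \in S -> s k != 0) -> f = 0.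
Proof.
move=> /radial_limit_trig_poly[l hl] s0.
pose b (sigma : R) := \sum_(k <- S | s k == sigma) a k.
have group (phi : R -> R[i]) :
    \sum_(k <- S) a k * phi (s k) = \sum_(sigma <- undup (map s S)) b sigma * phi sigma.
  under [RHS]eq_bigr do rewrite mulr_suml big_mkcond /=.
  rewrite exchange_big/= [LHS]big_seq [RHS]big_seq; apply: eq_bigr => k kS.
  have ks : s k \in undup (map s S) by rewrite mem_undup map_f.
  rewrite (bigD1_seq (s k))//= ?undup_uniq// eqxx big1 ?addr0// => i ik.
  by rewrite eq_sym (negbTE ik).
have b0 sigma : sigma \in undup (map s S) -> b sigma = 0.
  move=> hs; have sn0 : sigma != 0.
    by move: hs; rewrite mem_undup => /mapP[k kS ->]; exact: s0.
  apply: (@trig_poly_limit _ _ (undup (map s S)) b id l) => //.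
    exact: undup_uniq.
  apply: tends_at_infinity_ext hl => x.
  by rewrite (group (fun t => cis (t * x))).
apply/val_inj/funext => z; rewrite -[LHS]/(sval f z) -[RHS]/(0 : R[i]) fE.
rewrite (group (fun t => cexp ((0 +i* t) * ph (sval z)))) big_seq big1// => i hi.
by rewrite b0// mul0r.
Qed.

End RadialLimit.

(** The generators of the algebra. *)
Definition gen_set : set (Hinf R) := range (gen \o @trace_real R).

Lemma gen_set_param (N : nat) (g : 'I_N -> Hinf R) : (forall i, gen_set (g i)) ->
  exists x : 'I_N -> R, g = (fun i => gen (trace_real (x i))).
Proof.
move=> Gg; have /choice[x hx] : forall i, exists x, g i = gen (trace_real x).
  by move=> i; have [x _ <-] := Gg i; exists x.
by exists x; apply/funext.
Qed.

Section CoveredPoint.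
Variable w : R[i].
Hypothesis w1 : cmod w = 1.
Hypothesis wcover : forall n, exists k, cmod (1 - alpha n k * w) <= d n k.

Lemma generated_no_radial_limit f : generated_subalg gen_set f -> f != 0 ->
  ~ has_radial_limit f w.
Proof.
move=> [N [g [Q [Gg Q0 fE]]]] f0 hf.
have [x gE] := gen_set_param Gg; rewrite gE in fE.
case/eqP : f0.
apply: (@radial_limit_eq0 w _ (msupp Q) (fun m => mcoeff m Q)
  (freq (fun i => trace_real (x i)))) => //.
  by move=> z; rewrite fE mpoly_eval_gen.
move=> m mQ; apply: freq_neq0; apply: contraTneq mQ => ->.
by rewrite mcoeff_msupp Q0 eqxx.
Qed.

Lemma has_radial_limit0 : has_radial_limit (0 : Hinf R) w.
Proof.
rewrite /has_radial_limit (_ : (fun r : R => _) = cst 0); first exact: is_cvg_cst.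
by apply/funext => r; rewrite /disc_ext; case: insub.
Qed.

(** A relation between distinct generators is an exponential sum which
    vanishes identically, hence has radial limits. *)
Lemma gen_set_independent : alg_independent gen_set.
Proof.
move=> N g Gg g_inj Q QN0; apply/eqP => E.
have [x gE] := gen_set_param Gg; rewrite gE in E.
have x_inj : injective x.
  by move=> i j xij; apply: g_inj; rewrite gE xij.
have E' z : sval (0 : Hinf R) z = \sum_(m <- msupp Q) mcoeff m Q *
    cexp ((0 +i* freq (fun i => trace_real (x i)) m) * ph (sval z)).
  by rewrite -mpoly_eval_gen E.
have [l hl] := radial_limit_trig_poly w1 wcover E' has_radial_limit0.
have Q0 m : m != mnm0 -> mcoeff m Q = 0.
  move=> m0; have [mQ|] := boolP (m \in msupp Q); last exact: memN_msupp_eq0.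
  apply: (trig_poly_limit _ _ hl mQ); last exact: freq_neq0.
    exact: msupp_uniq.
  by move=> ? ? _ _; exact: freq_inj.
case/eqP: QN0; apply/mpolyP => m; rewrite mcoeff0.
have [->|/Q0//] := eqVneq m mnm0.
have [mQ|] := boolP (mnm0 \in msupp Q); last exact: memN_msupp_eq0.
have z : disc R by exact: point.
have := E' z; rewrite (bigD1_seq mnm0)//= ?msupp_uniq// big1 ?addr0.
  rewrite /freq big1 => [|i _]; last by rewrite mnmE mul0r.
  by rewrite mul0r cexp0 mulr1 => <-.
by move=> m' m'0; rewrite Q0// mul0r.
Qed.

End CoveredPoint.

Lemma gen_trace_inj (w : R[i]) : cmod w = 1 ->
  (forall n, exists k, cmod (1 - alpha n k * w) <= d n k) ->
  injective (gen \o @trace_real R).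
Proof.
move=> w1 wcover x y /= xy; apply/trace_real_inj/eqP; apply: contraT => nxy.
pose s (b : bool) := trace_real (if b then x else y).
have E (z : disc R) : sval (0 : Hinf R) z = \sum_(b <- [:: true; false])
    (-1) ^+ b * cexp ((0 +i* s b) * ph (sval z)).
  have /(congr1 (fun f : Hinf R => sval f z)) /= := xy.
  rewrite !big_cons big_nil /= expr1 expr0 mulN1r mul1r addr0 => Exy.
  by rewrite /s -/(phase_exp alpha d _ _) -/(gen_fun _ _) Exy addNr.
have [l hl] := radial_limit_trig_poly w1 wcover E (@has_radial_limit0 w).
have := @trig_poly_limit _ _ [:: true; false] (fun b => (-1) ^+ b) s l
  isT _ hl true isT.
rewrite gt_eqF ?trace_real_gt0//= expr1 => /(_ _ isT)/eqP.
rewrite oppr_eq0 oner_eq0; apply => -[] [] //= _ _; rewrite /s => /eqP.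
  by rewrite (negbTE nxy).
by rewrite eq_sym (negbTE nxy).
Qed.

End Generators.

Theorem theorem1p1 (R : realType) (E : set R[i])
    (E_circle : E `<=` unit_circle R) (E_null : circle_null E) :
  (exists B : set (Hinf R),
      subalg_of_dimension [set: R] B /\
      forall f : Hinf R, B f -> f != 0 ->
        forall w : R[i], E w -> ~ has_radial_limit f w)
  /\ strongly_algebrable [set: R]
       [set f : Hinf R | forall w : R[i], E w -> ~ has_radial_limit f w].
Proof.
have [alpha [d [alpha1 d0 dsum cover]]] := circle_null_rows E_null.
have one1 : cmod (1 : R[i]) = 1 by exact: cmod1.
have cover1 := cover _ one1 (or_intror erefl).
pose G := gen_set alpha1 d0 dsum.
have dimB : subalg_of_dimension [set: R] (generated_subalg G).
  exists G; split=> //; first exact: (gen_set_independent one1 cover1).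
  apply: inj_card_eq => x y _ _; exact: (gen_trace_inj one1 cover1).
have noB f : generated_subalg G f -> f != 0 ->
    forall w : R[i], E w -> ~ has_radial_limit f w.
  move=> Bf f0 w Ew; have w1 : cmod w = 1 by have [] := E_circle w Ew.
  exact: (generated_no_radial_limit w1 (cover w w1 (or_introl Ew)) Bf f0).
split; exists (generated_subalg G); split=> // f Bf.
have [->|f0] := eqVneq f 0; first by right.
by left => w Ew; exact: noB.
Qed.
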